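(* Let $\frac12\le H_1<H_2<1$, and let $\kappa$ and $\gamma_{H_1}$ be the kernel and the constant defined in the context. There exists a sequence of positive numbers $T_n\to\infty$ such that for every $n$ the integral equation $$h(u)+\frac{1}{\gamma_{H_1}^2}\int_0^{T_n}h(s)\,\kappa(s,u)\,ds=1,\qquad u\in[0,T_n],$$ has a unique solution $h=h_{T_n}\in C[0,T_n]$.
   Context: Here $\Gamma$ is the gamma function and $\mathrm{B}(\alpha,\beta)=\int_0^1x^{\alpha-1}(1-x)^{\beta-1}dx$ is the beta function. Constants: $\gamma_H=\left(2H\left(\tfrac32-H\right)\Gamma\left(\tfrac32-H\right)^3\Gamma\left(H+\tfrac12\right)\Gamma(3-2H)^{-1}\right)^{1/2}$ and $\beta_H=\left(\frac{H(2H-1)}{\mathrm{B}(H-1/2,\,2-2H)}\right)^{1/2}$. For $0<s<t$ put $$K_{H_1,H_2}(t,s)=\beta_{H_2}s^{1/2-H_2}\int_s^t(t-u)^{1/2-H_1}u^{H_2-H_1}(u-s)^{H_2-3/2}\,du .$$ For $s,u>0$, $s\ne u$, put $$k(s,u)=\int_0^{s\wedge u}\partial_sK_{H_1,H_2}(s,v)\,\partial_uK_{H_1,H_2}(u,v)\,dv,$$ where $\partial_s K_{H_1,H_2}(s,v)$ and $\partial_u K_{H_1,H_2}(u,v)$ denote derivatives with respect to the first argument of $K_{H_1,H_2}$, and $s\wedge u=\min(s,u)$. Put $$\kappa(s,u)=u^{2H_1-1}k(s,u).$$ Conventions on a null set: $\kappa(s,s)=0$, and $\kappa(s,0)=\lim_{u\downarrow0}\kappa(s,u)$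 for $s>0$. $C[0,T]$ is the space of continuous real-valued functions on $[0,T]$. *)

(* Defs.v *)
From HB Require Import structures.
From mathcomp Require Import all_boot all_order all_algebra.
From mathcomp Require Import all_classical all_reals all_analysis.

Set Implicit Arguments.
Unset Strict Implicit.
Unset Printing Implicit Defensive.
Import Order.TTheory GRing.Theory Num.Theory.
Import numFieldNormedType.Exports.
Local Open Scope classical_set_scope.
Local Open Scope ring_scope.

(* Integrals are Lebesgue integrals. The real powers [x `^ a] below are
   evaluated at [x > 0] except on null sets: [0 `^ a = 0] for [a != 0]. *)

Definition Gamma {R : realType} (a : R) : R :=
  \int[lebesgue_measure]_(x in `]0, +oo[) (x `^ (a - 1) * expR (- x)).

Definition Beta {R : realType} (a b : R) : R :=
  \int[lebesgue_measure]_(x in `]0, 1[) (x `^ (a - 1) * (1 - x) `^ (b - 1)).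

Definition gammaH {R : realType} (H : R) : R :=
  Num.sqrt (2 * H * (3 / 2 - H) * Gamma (3 / 2 - H) ^+ 3 * Gamma (H + 1 / 2)
            * (Gamma (3 - 2 * H))^-1).

Definition betaH {R : realType} (H : R) : R :=
  Num.sqrt (H * (2 * H - 1) / Beta (H - 1 / 2) (2 - 2 * H)).

(* Meaningful for [0 < s < t]. *)
Definition Kker {R : realType} (H1 H2 t s : R) : R :=
  betaH H2 * s `^ (1 / 2 - H2) *
  \int[lebesgue_measure]_(u in `]s, t[)
    ((t - u) `^ (1 / 2 - H1) * u `^ (H2 - H1) * (u - s) `^ (H2 - 3 / 2)).

(* Derivative with respect to the first argument of [Kker]. *)
Definition dKker {R : realType} (H1 H2 t s : R) : R :=
  derive1 (fun x : R => Kker H1 H2 x s) t.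

Definition kker {R : realType} (H1 H2 s u : R) : R :=
  \int[lebesgue_measure]_(v in `]0, Num.min s u[)
    (dKker H1 H2 s v * dKker H1 H2 u v).

(* Off the diagonal and for [u > 0] this is [u ^ (2 H1 - 1) k(s, u)]; on the
   axis [u = 0] it is the right limit of that expression. *)
Definition kappa {R : realType} (H1 H2 s u : R) : R :=
  if s == u then 0
  else if u == 0 then lim (x `^ (2 * H1 - 1) * kker H1 H2 s x @[x --> 0^'+])
  else u `^ (2 * H1 - 1) * kker H1 H2 s u.

(* [h] represents an element of C[0, T] by its restriction to [0, T]. The
   equation is stated in [\bar R], so it forces the integral to be finite. *)
Definition is_solution {R : realType} (H1 H2 T : R) (h : R -> R) : Prop :=
  {within `[0, T], continuous h} /\
  forall u : R, 0 <= u <= T ->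
    ((h u)%:E + ((gammaH H1 ^+ 2)^-1)%:E *
       \int[lebesgue_measure]_(s in `[0%R, T]) (h s * kappa H1 H2 s u)%:E = 1)%E.

(* Main.v *)
From mathcomp Require Import all_boot all_order all_algebra.
From mathcomp Require Import all_classical all_reals all_analysis.
From mathcomp Require Import measurable_realfun ring lra.
Require Import Defs.

Set Implicit Arguments.
Unset Strict Implicit.
Unset Printing Implicit Defensive.
Import Order.TTheory GRing.Theory Num.Theory.
Import numFieldNormedType.Exports.
Local Open Scope classical_set_scope.
Local Open Scope ring_scope.

(** Put a = H2 - H1 and r = 2 H2 - 1. The substitution u = v + (s - v) z in K and
    differentiation under the integral give
    d/ds K(s, v) = v ^ (1/2 - H2) N(s, v), where N(s, v) = O((s - v) ^ (a - 1)) is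
    homogeneous of degree 2 a - 1. With (G h)(v) = int_v^T N(s, v) h(s) ds and
    m(y) = y ^ (- r) N(1, y), Fubini and v = u y turn the integral term into
    (A h)(u) = int_0^1 m(y) (G h)(u y) dy, an operator on C[0, T]. It is positive
    for the weight u ^ (1 - 2 H1):
    int_0^T u ^ (1 - 2 H1) h (A h) du = int_0^T v ^ (- r) (G h)(v) ^ 2 dv >= 0,
    so h + l A h = f bounds h in L^1 by the sup norm of f; since the kernel is
    weakly singular, |A h| <= e sup |h| + C_e |h|_1 for every e > 0, which upgrades
    this to a bound on sup |h| that is uniform for l in a bounded interval.
    Uniqueness follows, and existence by continuation in l from l = 0, each step
    being a contraction. This works for every T > 0. *)

(** Formally k is the Gram kernel of the functions v -> d/ds K(s, v), which explains both the square
    in the energy and the weight: u ^ (1 - 2 H1) removes the factor u ^ (2 H1 - 1) that makes kappa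
    asymmetric. These functions are not square integrable: the product has order (u - v) ^ (2 a - 2)
    at s = u, and a < 1/2. So the diagonal is cut out, and Fubini is justified by domination rather
    than by an L^2 argument. The power u ^ (2 H1 - 1) also cancels the power u ^ (2 a - r) created
    by scaling, because r - 2 a = 2 H1 - 1. Hence A carries no power of u and makes sense at u = 0,
    where kappa is only given as a limit. Positivity controls a quadratic form and not the sup norm.
    The weight is at least T ^ (1 - 2 H1) on ]0, T] and integrable since H1 < 1, which is enough for
    an L^1 bound. Functions on [0, T] are extended to the line by a retraction, so sup norms are
    plain pointwise bounds over R. *)

(** * Fixed points and the continuity method for bounded continuous functions *)

Section bounded_continuous.
Context {R : realType}.
Implicit Types (f g h : R -> R) (c : R).

Definition bounded_continuous h := continuous h /\ exists M : R, forall x, `|h x| <= M.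

Lemma bounded_continuousB g h : bounded_continuous g -> bounded_continuous h ->
  bounded_continuous (fun x => g x - h x).
Proof.
move=> [cg [M gM]] [ch [N hN]]; split; first by move=> x; apply: cvgB; [exact: cg|exact: ch].
by exists (M + N) => x; rewrite (le_trans (ler_normB _ _))// lerD.
Qed.

Lemma bounded_continuousZ (k : R) h : bounded_continuous h ->
  bounded_continuous (fun x => k * h x).
Proof.
move=> [ch [N hN]]; split.
  by move=> x; apply: cvgM; [exact: cvg_cst|exact: ch].
by exists (`|k| * N) => x; rewrite normrM ler_wpM2l.
Qed.

(** An e/3 argument; it supplies the completeness behind [picard]. *)
Lemma bounded_continuous_uniform_closure h :
  (forall e, 0 < e -> exists2 g, bounded_continuous g & forall x, `|h x - g x| <= e) ->
  bounded_continuous h.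
Proof.
move=> happ; split; last first.
  have [g [_ [M gM]] hg] := happ 1 ltr01.
  exists (1 + M) => x.
  by rewrite -[h x](subrK (g x)) (le_trans (ler_normD _ _))// lerD.
move=> x; apply/cvgrPdist_le => e e0.
have [g [cg _] hg] := happ (e / 3) ltac:(by rewrite divr_gt0).
have /cvgrPdist_le/(_ (e / 3)) := cg x.
move=> /(_ ltac:(by rewrite divr_gt0)); apply: filterS => y gy.
have := hg x; have := hg y; move: gy; rewrite !ler_norml; lra.
Qed.

(** Banach's fixed point theorem with ratio 1/2, phrased with pointwise bounds so that no normed
    function space has to be constructed. The iterates start from 0. *)
Lemma picard (F : (R -> R) -> R -> R) :
  (forall h, bounded_continuous h -> bounded_continuous (F h)) ->
  (forall g h c, bounded_continuous g -> bounded_continuous h -> 0 < c ->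
    (forall x, `|g x - h x| <= c) -> forall x, `|F g x - F h x| <= c / 2) ->
  exists2 h, bounded_continuous h & F h = h.
Proof.
move=> FS Fhalf.
pose u n := iter n F (cst 0).
have uS n : bounded_continuous (u n).
  elim: n => [|n /FS//]; split; first by move=> x; exact: cvg_cst.
  by exists 0 => x; rewrite normr0.
have [_ [c0 Hc0]] := uS 1%N.
(* The maximum with 1 makes [c] positive, as the contraction hypothesis demands. *)
pose c : R := Num.max c0 1.
have c_gt0 : 0 < c by rewrite /c lt_max ltr01 orbT.
have step n x : `|u n.+1 x - u n x| <= c * 2^-1 ^+ n.
  elim: n x => [x|n IH x].
    by rewrite expr0 mulr1 /u /= subr0 /c le_max; rewrite Hc0.
  rewrite exprSr mulrA; apply: (Fhalf (u n.+1) (u n)) => //.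
  by rewrite mulr_gt0// exprn_gt0// invr_gt0.
(* The exact tail of the geometric series is kept: with the weaker bound 2 c / 2 ^ n alone, the
   induction on [m] would not close. *)
have dist n m x : `|u (n + m)%N x - u n x| <= 2 * c * 2^-1 ^+ n - 2 * c * 2^-1 ^+ (n + m).
  elim: m => [|m IH]; first by rewrite addn0 !subrr normr0.
  rewrite addnS exprS; have := step (n + m)%N x.
  move: IH; rewrite !ler_norml; lra.
have pow0 : (2 * c) * 2^-1 ^+ n @[n --> \oo] --> (0 : R).
  rewrite -[X in _ --> X](mulr0 (2 * c)); apply: cvgM; first exact: cvg_cst.
  by apply: cvg_expr; rewrite ger0_norm// invf_lt1// ltr1n.
have dist' n m x : `|u (n + m)%N x - u n x| <= 2 * c * 2^-1 ^+ n.
  rewrite (le_trans (dist n m x))// gerBl mulr_ge0 ?mulr_ge0 ?(ltW c_gt0)//.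
have cvgu x : cvg (u n x @[n --> \oo]).
  apply/cauchy_cvgP/cauchy_exP => e e0.
  have /cvgrPdist_lt/(_ e e0)[N _ HN] := pow0.
  exists (u N x), N => // n /= Nn; rewrite /ball/= distrC.
  rewrite -(subnKC Nn) (le_lt_trans (dist' _ _ _))//.
  by have := HN N (leqnn N); rewrite sub0r normrN; apply: le_lt_trans; exact: ler_norm.
pose h x := lim (u n x @[n --> \oo]).
have hu n x : `|h x - u n x| <= 2 * c * 2^-1 ^+ n.
  have cv : `|u (n + m)%N x - u n x| @[m --> \oo] --> `|h x - u n x|.
    apply: cvg_norm; apply: cvgB; last exact: cvg_cst.
    under eq_fun do rewrite addnC.
    have : u^~ x @ \oo --> h x by exact: cvgu.
    by rewrite -(cvg_shiftn n).
  rewrite -(cvg_lim _ cv)//; apply: limr_le; first exact: cvgP cv.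
  by apply: nearW => m; exact: dist'.
have hS : bounded_continuous h.
  apply: bounded_continuous_uniform_closure => e e0.
  have /cvgrPdist_lt/(_ e e0)[N _ HN] := pow0.
  exists (u N) => // x; rewrite (le_trans (hu N x))//.
  by have := HN N (leqnn N); rewrite sub0r normrN => /ltW; apply: le_trans; exact: ler_norm.
(* Both [h] and [F h] are within c / 2 ^ N of the iterate of index N + 1, which is [F (u N)]. *)
exists h => //; apply/funext => x; apply/eqP; rewrite -subr_eq0 -normr_le0.
apply/ler_addgt0Pr => e e0; rewrite add0r.
have /cvgrPdist_lt/(_ (e / 2) ltac:(by rewrite divr_gt0))[N _ HN] := pow0.
have E0 := HN N (leqnn N); rewrite /= sub0r normrN in E0.
have {}E0 := le_lt_trans (ler_norm _) E0.
have := hu N.+1 x; rewrite exprS /u /= -/(u N) => h1.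
have := Fhalf h (u N) _ hS (uS N) _ (hu N) x => /(_ ltac:(by rewrite !mulr_gt0// exprn_gt0)) h2.
move: h1 h2 E0; rewrite !ler_norml; lra.
Qed.

(* The hypothesis is applied to M = sup |h|. *)
Lemma norm_le_absorb h (K M0 : R) : (forall x, `|h x| <= M0) ->
  (forall M, (forall x, `|h x| <= M) -> forall x, `|h x| <= K + M / 2) ->
  forall x, `|h x| <= 2 * K.
Proof.
move=> hM0 habs x.
pose E := range (fun x => `|h x|).
have E0 : E !=set0 by exists `|h x|; exists x.
have supE : has_sup E by split => //; exists M0 => _ [y _ <-].
have hsup y : `|h y| <= sup E by apply: ub_le_sup; [exact: supE.2|exists y].
have : sup E <= K + sup E / 2 by apply: ge_sup => // _ [y _ <-]; exact: habs.
have := hsup x; lra.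
Qed.

(** If S solves the equation at [l], then the equation at [l + e] is the fixed point problem h = S
    (f - e A h), with Lipschitz constant at most e C M. Since [M] serves all [l] up to [L], the step
    length [del] = 1 / (2 C M) is the same everywhere and finitely many steps reach any [l]. *)
Lemma continuity_method (A : (R -> R) -> R -> R) (C M L : R) : 0 < C -> 0 < M ->
  (forall h, bounded_continuous h -> bounded_continuous (A h)) ->
  (forall g h, bounded_continuous g -> bounded_continuous h ->
    forall x, A (fun y => g y - h y) x = A g x - A h x) ->
  (forall h c, bounded_continuous h -> (forall x, `|h x| <= c) ->
    forall x, `|A h x| <= C * c) ->
  (forall l, 0 <= l <= L -> forall h c, bounded_continuous h -> 0 < c ->
    (forall x, `|h x + l * A h x| <= c) -> forall x, `|h x| <= M * c) ->
  forall l, 0 <= l <= L -> forall f, bounded_continuous f ->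
  exists2 h, bounded_continuous h & forall x, h x + l * A h x = f x.
Proof.
move=> C0 M0 AS AB AC apriori.
have CM0 : 0 < C * M by rewrite mulr_gt0.
pose del := (2 * (C * M))^-1.
have del0 : 0 < del by rewrite invr_gt0 mulr_gt0.
have deltaC : del * (C * M) = 2^-1.
  by rewrite /del invfM -mulrA mulVf ?mulr1// gt_eqF.
have step (l e : R) : 0 <= l <= L -> 0 <= e <= del ->
    (forall f, bounded_continuous f ->
      exists2 h, bounded_continuous h & forall x, h x + l * A h x = f x) ->
    forall f, bounded_continuous f ->
      exists2 h, bounded_continuous h & forall x, h x + (l + e) * A h x = f x.
  move=> l0L e0d solve f fS.
  (* A total solution operator at [l]; on functions that are not bounded continuous it takes the
     junk value 0. *)
  have /choice[sol solP] : forall f, exists h, bounded_continuous f ->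
      bounded_continuous h /\ forall x, h x + l * A h x = f x.
    move=> k; have [/solve[h hS hk]|nk] := pselect (bounded_continuous k).
      by exists h.
    by exists (cst 0) => /nk.
  have rhsS h : bounded_continuous h -> bounded_continuous (fun x => f x - e * A h x).
    by move=> hS; apply: bounded_continuousB => //; exact/bounded_continuousZ/AS.
  have [|g h c gS hS c0 ghc|h hS hE] :=
      picard (F := fun h => sol (fun x => f x - e * A h x)).
  - by move=> h /rhsS/solP[].
  - have [sgS sgE] := solP _ (rhsS _ gS); have [shS shE] := solP _ (rhsS _ hS).
    set sg := sol _ in sgS sgE *; set sh := sol _ in shS shE *.
    have diffS := bounded_continuousB sgS shS.
    have dS := bounded_continuousB gS hS.
    (* The difference d of two images solves d + l A d = - e A (g - h), so the a priori bound
       applies to it. *)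
    have key x : `|(sg x - sh x) + l * A (fun y => sg y - sh y) x| <= del * (C * c).
      have -> : sg x - sh x + l * A (fun y => sg y - sh y) x
              = - (e * A (fun y => g y - h y) x).
        rewrite !AB//; have := sgE x; have := shE x; lra.
      case/andP : e0d => e0 ed.
      rewrite normrN normrM ger0_norm// ler_pM//; exact: AC.
    move=> x; have := apriori _ l0L _ _ diffS _ key x.
    move=> /(_ ltac:(by rewrite !mulr_gt0)).
    have -> // : M * (del * (C * c)) = c / 2 by rewrite -deltaC; ring.
  - exists h => // x; have [_ /(_ x)] := solP _ (rhsS _ hS).
    by rewrite hE; lra.
have main (n : nat) : forall l : R, 0 <= l <= L -> l <= n%:R * del ->
    forall f, bounded_continuous f ->
      exists2 h, bounded_continuous h & forall x, h x + l * A h x = f x.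
  elim: n => [|n IH] l /andP[l0 lL].
    rewrite mul0r => l0' f fS; exists f => // x.
    by rewrite (le_anti (introT andP (conj l0' l0))) mul0r addr0.
  (* A parameter below [del] is reached from 0, where the equation reads h = f; a larger one is
     reached from [l - del]. *)
  move=> ln; have [ld|dl] := leP l del.
    rewrite -[l]add0r; apply: step; rewrite ?lexx ?l0//; first exact: le_trans lL.
    by move=> f fS; exists f => // x; rewrite mul0r addr0.
  rewrite -[l](subrK del); apply: step; rewrite ?lexx ?(ltW del0)//.
    by rewrite subr_ge0 (ltW dl) (le_trans _ lL)// gerBl ltW.
  apply: IH; first by rewrite subr_ge0 (ltW dl) (le_trans _ lL)// gerBl ltW.
  by rewrite lerBlDr (le_trans ln)// -natr1 mulrDl mul1r.
move=> l l0L; apply: (main (Num.bound (l / del)).+1) => //.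
case/andP: l0L => l0 _.
rewrite -ler_pdivrMr//; apply: ltW; apply: lt_le_trans (archi_boundP _) _.
  by rewrite divr_ge0// ltW.
by rewrite ler_nat.
Qed.
End bounded_continuous.

(** * Affine change of variables and integrals of powers *)

Section affine_substitution.
Context {R : realType}.
Notation mu := (@lebesgue_measure R).

Lemma measurable_affine (c k : R) : measurable_fun [set: R] (fun z => c + k * z).
Proof. by apply: measurable_funD => //; exact: measurable_funM. Qed.

(** The right-hand side is a scaled pushforward, hence a measure in [A], and it gives every interval
    []a, b]] its length; Lebesgue measure is the only such measure. *)
Lemma lebesgue_measure_affine (c k : R) (A : set R) : 0 < k -> measurable A ->
  mu A = (k%:E * mu ((fun z => (c + k * z)%R) @^-1` A))%E.
Proof.
move=> k0 mA.
have mphi : measurable_fun setT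
    (fun z : measurableTypeR R => (c + k * z : measurableTypeR R)).
  exact: measurable_affine.
pose kn : {nonneg R} := NngNum (ltW k0).
pose nu := mscale kn (measure_function_pushforward__canonical__measure_function_Measure mu mphi : {measure set _ -> \bar R}).
rewrite -[RHS]/(nu A).
apply: lebesgue_measure_unique => //= _ [[a b]] _ <-.
rewrite /nu /mscale/= /pushforward.
have -> : (fun z => c + k * z) @^-1` `]a, b] = `](a - c) / k, (b - c) / k]%classic.
  apply/seteqP; split => x /=; rewrite !in_itv/= ltr_pdivrMr// ler_pdivlMr//;
    by rewrite ltrBlDl lerBrDl [x * _]mulrC.
rewrite !lebesgue_measure_itv/= !lte_fin ltr_pM2r ?invr_gt0// ltrD2r.
case: ifP => _; last by rewrite mule0.
rewrite -!EFinB -EFinM; congr EFin.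
by rewrite -mulrBl mulrCA divff ?gt_eqF// mulr1; ring.
Qed.

Lemma ge0_integral_affine (f : R -> \bar R) (c k : R) (D : set R) : 0 < k ->
  measurable D -> measurable_fun D f -> (forall x, D x -> 0 <= f x)%E ->
  (\int[mu]_(x in D) f x =
   k%:E * \int[mu]_(z in (fun z => (c + k * z)%R) @^-1` D) f (c + k * z)%R)%E.
Proof.
move=> k0 mD mf f0.
pose kn : {nonneg R} := NngNum (ltW k0).
have mphi : measurable_fun setT
    (fun z : measurableTypeR R => (c + k * z : measurableTypeR R)).
  exact: measurable_affine.
have := ge0_integral_pushforward mphi mu mD mf.
move=> /(_ ltac:(by move=> y /set_mem; exact: f0)).
rewrite /comp => <-.
rewrite -[k in RHS]/(kn%:num) -ge0_integral_mscale//.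
apply: eq_measure_integral => A mA _.
exact: (@lebesgue_measure_affine c k).
Qed.

(** Positive and negative parts are treated separately. A finite positive factor distributes over a
    difference of extended reals even when both terms are infinite, so measurability of [f]
    suffices. *)
Lemma integral_affine (f : R -> \bar R) (c k : R) (D : set R) : 0 < k ->
  measurable D -> measurable_fun D f ->
  (\int[mu]_(x in D) f x =
   k%:E * \int[mu]_(z in (fun z => (c + k * z)%R) @^-1` D) f (c + k * z)%R)%E.
Proof.
move=> k0 mD mf.
rewrite integralE [in RHS]integralE.
rewrite (ge0_integral_affine c k0)//; last exact: measurable_funepos.
rewrite [X in (_ - X)%E = _](ge0_integral_affine c k0)//; last exact: measurable_funeneg.
have kl (x y : \bar R) : (k%:E * x - k%:E * y = k%:E * (x - y))%E.
  have ky : (k%:E * +oo = +oo)%E by rewrite gt0_muley ?lte_fin.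
  have kNy : (k%:E * -oo = -oo)%E by rewrite gt0_muleNy ?lte_fin.
  case: x => [x| |]; case: y => [y| |]; rewrite ?ky ?kNy.
  - by rewrite -!EFinM -!EFinB mulrBr.
  all: rewrite ?oppey ?oppeNy -?EFinM ?addeNy ?addNye ?ky ?kNy//.
by rewrite kl; congr (_ * (_ - _))%E; apply: eq_integral => x _; rewrite ?funeposE ?funenegE.
Qed.

Lemma preimage_affine_itv (a b : R) : a < b ->
  (fun z => a + (b - a) * z) @^-1` `]a, b[ = `]0, 1[%classic.
Proof.
move=> ab; have ba0 : 0 < b - a by rewrite subr_gt0.
apply/seteqP; split => z /=; rewrite !in_itv/= => /andP[h1 h2]; apply/andP; split.
- by rewrite -(pmulr_rgt0 _ ba0); lra.
- by rewrite -(ltr_pM2l ba0) mulr1; lra.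
- by have := mulr_gt0 ba0 h1; lra.
- by move: h2; rewrite -(ltr_pM2l ba0) mulr1; lra.
Qed.

Lemma integral_itv01 (f : R -> \bar R) (a b : R) : a < b ->
  measurable_fun `]a, b[ f ->
  (\int[mu]_(x in `]a, b[) f x =
   (b - a)%:E * \int[mu]_(z in `]0%R, 1%R[) f (a + (b - a) * z)%R)%E.
Proof.
move=> ab mf; have ba0 : 0 < b - a by rewrite subr_gt0.
by rewrite (integral_affine a ba0)// preimage_affine_itv.
Qed.

Lemma Rintegral_itv01 (f : R -> R) (a b : R) : a < b ->
  measurable_fun `]a, b[ f ->
  \int[mu]_(x in `]a, b[) f x =
   (b - a) * \int[mu]_(z in `]0, 1[) f (a + (b - a) * z).
Proof.
move=> ab mf; rewrite /Rintegral (integral_itv01 ab); last exact/measurable_EFinP.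
have ba0 : (0 < (b - a)%:E)%E by rewrite lte_fin subr_gt0.
have fineM' (x : \bar R) : fine ((b - a)%:E * x) = (b - a) * fine x.
  by case: x => [r //| |]; rewrite ?gt0_muley ?gt0_muleNy ?mulr0.
exact: fineM'.
Qed.


Lemma cvg_powR (a x : R) : 0 < x -> (y `^ a) @[y --> x] --> x `^ a.
Proof.
move=> x0; suff : {for x, continuous (fun y : R => y `^ a)} by [].
apply: differentiable_continuous; apply/derivable1_diffP.
by apply: derivable_powR; rewrite in_itv/= x0.
Qed.

Lemma within_continuous_powR (e a b : R) : 0 < a ->
  {within `[a, b], continuous (fun z : R => z `^ e)}.
Proof.
move=> a0; apply: continuous_in_subspaceT => z /set_mem/=; rewrite in_itv/= => /andP[az _].
by apply: cvg_powR; exact: lt_le_trans az.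
Qed.

Lemma integral_powR_itv (e a b : R) : e != 0 -> 0 < a -> a < b ->
  (\int[mu]_(z in `[a, b]) (z `^ (e - 1))%:E = (e^-1 * (b `^ e - a `^ e))%:E)%E.
Proof.
move=> e0 a0 ab.
have b0 := lt_trans a0 ab.
have dF (z : R) : 0 < z -> is_derive z 1 (fun z : R => e^-1 * z `^ e) (z `^ (e - 1)).
  move=> z0; have : is_derive z 1 (e^-1 *: (fun z : R => z `^ e)) (e^-1 *: (e * z `^ (e - 1))).
    by apply: is_deriveZ; exact: is_derive1_powR.
  by rewrite scalerA mulVf// scale1r.
have cF (z : R) : 0 < z -> (fun z : R => e^-1 * z `^ e) @ z --> e^-1 * z `^ e.
  by move=> z0; apply: cvgM; [exact: cvg_cst|exact: cvg_powR].
rewrite (continuous_FTC2 (F := fun z : R => e^-1 * z `^ e))//.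
- by rewrite -EFinB mulrBr.
- exact: within_continuous_powR.
- split.
  + move=> z; rewrite in_itv/= => /andP[az _].
    by have [] := dF z (lt_trans a0 az).
  + by apply: cvg_at_right_filter; exact: cF.
  + by apply: cvg_at_left_filter; exact: cF.
- move=> z; rewrite in_itv/= => /andP[az _].
  by rewrite derive1E; have [_ ->] := dF z (lt_trans a0 az).
Qed.

Lemma measurable_powR_itv (e : R) (D : set R) : measurable_fun D (fun z : R => z `^ e).
Proof. by apply: measurable_funTS; exact: measurable_powR. Qed.

(** Truncating at 1 / (n + 1) and using monotone convergence reduces this to [integral_powR_itv],
    whose values all stay below 1 / e. *)
Lemma integrable_powR01 (e : R) : 0 < e ->
  mu.-integrable `]0, 1[ (EFin \o (fun z => z `^ (e - 1))).
Proof.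
move=> e0; apply/integrableP; split.
  by apply/measurable_EFinP; exact: measurable_powR_itv.
under eq_integral do rewrite /= ger0_norm ?powR_ge0//.
pose g n := ((fun z : R => z `^ (e - 1)) \_ `[n.+1%:R^-1, +oo[) : R -> R.
have mg n : measurable_fun (`]0, 1[ : set R) (g n).
  apply: (measurable_funS measurableT) => //.
  apply/(measurable_restrictT _ _).1 => //; exact: measurable_powR_itv.
have g0 n x : 0 <= g n x by rewrite /g patchE; case: ifP => // _; exact: powR_ge0.
have -> : (\int[mu]_(x in `]0%R, 1%R[) (x `^ (e - 1))%:E =
    limn (fun n => \int[mu]_(x in `]0%R, 1%R[) (g n x)%:E))%E.
  rewrite -monotone_convergence//.
  - apply: eq_integral => x; rewrite inE/= in_itv/= => /andP[x0 _].
    apply/esym/cvg_lim => //; apply: cvg_near_cst.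
    near=> n; rewrite /g patchE mem_set//= in_itv/= andbT.
    rewrite invf_ple ?posrE//; apply: (@le_trans _ _ n%:R); last by rewrite ler_nat.
    by near: n; exact: nbhs_infty_ger.
  - by move=> n; apply/measurable_EFinP; exact: mg.
  - by move=> n x _; rewrite lee_fin.
  - move=> x _ m n mn; rewrite lee_fin /g !patchE; case: ifPn => [|_]; last first.
      by case: ifP => // _; exact: powR_ge0.
    rewrite inE/= in_itv/= andbT => mx; rewrite mem_set//= in_itv/= andbT.
    by rewrite (le_trans _ mx)// lef_pV2 ?posrE// ler_nat.
apply: (@le_lt_trans _ _ e^-1%:E); last exact: ltry.
apply: lime_le.
  apply: ereal_nondecreasing_is_cvgn => m n mn; apply: ge0_le_integral => //.
  - by move=> x _; rewrite lee_fin.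
  - by apply/measurable_EFinP; exact: mg.
  - by apply/measurable_EFinP; exact: mg.
  - move=> x _; rewrite lee_fin /g !patchE; case: ifPn => [|_]; last first.
      by case: ifP => // _; exact: powR_ge0.
    rewrite inE/= in_itv/= andbT => mx; rewrite mem_set//= in_itv/= andbT.
    by rewrite (le_trans _ mx)// lef_pV2 ?posrE// ler_nat.
apply: nearW => n.
have -> : (\int[mu]_(x in `]0%R, 1%R[) (g n x)%:E =
    \int[mu]_(x in `]0%R, 1%R[ `&` `[n.+1%:R^-1%R, +oo[) (x `^ (e - 1))%:E)%E.
  by rewrite integral_mkcondr; apply: eq_integral => x _; rewrite /g !patchE; case: ifP.
(* The left end is moved down to 1 / (n + 2) so that it is strictly below 1 even for n = 0. *)
apply: (@le_trans _ _ (\int[mu]_(x in `[n.+2%:R^-1%R, 1%R]) (x `^ (e - 1))%:E)%E).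
  apply: ge0_subset_integral => //=.
  - exact: measurableI.
  - by apply/measurable_EFinP; exact: measurable_powR_itv.
  - by move=> x _; rewrite lee_fin powR_ge0.
  - move=> x []/=; rewrite !in_itv/= andbT => /andP[_ /ltW x1] nx; rewrite x1 andbT.
    by rewrite (le_trans _ nx)// lef_pV2 ?posrE// ler_nat.
rewrite integral_powR_itv ?gt_eqF ?invr_gt0//; last by rewrite invf_lt1// ltr1n.
by rewrite lee_fin powR1 ler_piMr ?invr_ge0 ?(ltW e0)// gerBl powR_ge0.
Unshelve. all: end_near. Qed.

End affine_substitution.

(** * Domination for real-valued integrals *)

Section dominated_integrals.
Context d (T : measurableType d) {R : realType} (mu : {measure set T -> \bar R}).

Lemma integrable_dominated (D : set T) (w f : T -> R) : measurable D ->
  mu.-integrable D (EFin \o w) -> measurable_fun D f ->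
  (forall x, D x -> `|f x| <= w x) -> mu.-integrable D (EFin \o f).
Proof.
move=> mD iw mf fw; apply: le_integrable iw => //; first exact/measurable_EFinP.
by move=> x Dx /=; rewrite lee_fin (le_trans (fw x Dx))// ler_norm.
Qed.

Lemma Rintegral_dominated (D : set T) (w f : T -> R) : measurable D ->
  mu.-integrable D (EFin \o w) -> measurable_fun D f ->
  (forall x, D x -> `|f x| <= w x) ->
  `|\int[mu]_(x in D) f x| <= \int[mu]_(x in D) w x.
Proof.
move=> mD iw mf fw.
have if_ : mu.-integrable D (EFin \o f) by exact: integrable_dominated iw mf fw.
apply: le_trans; first exact: le_normr_Rintegral.
apply: le_Rintegral => //.
apply: (integrable_dominated mD iw) => //.
  exact: measurableT_comp.
by move=> x Dx; rewrite normr_id fw.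
Qed.

Lemma integrableZl_fin (D : set T) (k : R) (w : T -> R) : measurable D ->
  mu.-integrable D (EFin \o w) -> mu.-integrable D (EFin \o (fun x => k * w x)).
Proof.
move=> mD iw; have := integrableZl mD k iw.
apply: eq_integrable => // x _; rewrite /= EFinM.
Qed.

Lemma integrableD_fin (D : set T) (v w : T -> R) : measurable D ->
  mu.-integrable D (EFin \o v) -> mu.-integrable D (EFin \o w) ->
  mu.-integrable D (EFin \o (fun x => v x + w x)).
Proof.
move=> mD iv iw; have := integrableD mD iv iw.
apply: eq_integrable => // x _; rewrite /= EFinD.
Qed.

End dominated_integrals.

(** * Integrability of beta densities *)

Section integrability.
Context {R : realType}.
Notation mu := (@lebesgue_measure R).

Lemma integrable_cst_itv (x y k : R) : mu.-integrable `]x, y[ (EFin \o (fun=> k)).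
Proof.
apply/integrableP; split; first exact/measurable_EFinP.
rewrite integral_cst//= lebesgue_measure_itv/=.
by case: ifP => _; rewrite ?mule0 ?ltry// -EFinB -EFinM ltry.
Qed.

Lemma integrable_itv01 (f : R -> R) (x y : R) : x < y ->
  measurable_fun `]x, y[ f ->
  mu.-integrable `]0, 1[ (EFin \o (fun z => f (x + (y - x) * z))) ->
  mu.-integrable `]x, y[ (EFin \o f).
Proof.
move=> xy mf /integrableP[_ fi]; apply/integrableP; split; first exact/measurable_EFinP.
rewrite (integral_itv01 xy); last by apply/measurable_EFinP; exact: measurableT_comp.
apply: lte_mul_pinfty => //; first by rewrite lee_fin subr_ge0 ltW.
Qed.

(** The reflection z -> 1 - z has negative slope, so it is split into z -> - z, which preserves
    Lebesgue measure, and a translation of ]-1, 0[ covered by [integral_itv01]. *)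
Lemma integrable_onem_powR01 (e : R) : 0 < e ->
  mu.-integrable `]0, 1[ (EFin \o (fun z => (1 - z) `^ (e - 1))).
Proof.
move=> e0.
have mf : measurable_fun (setT : set R) (fun z : R => (1 - z) `^ (e - 1)).
  apply: (measurableT_comp (measurable_powR (e - 1))).
  exact: measurable_funB.
have mD : measurable (`]0, 1[ : set R) by [].
apply/integrableP; split; first by apply/measurable_EFinP; exact: measurable_funTS.
under eq_integral do rewrite /= ger0_norm ?powR_ge0//.
have mopp : measurable_fun setT (-%R : measurableTypeR R -> measurableTypeR R).
  exact: oppr_measurable.
have -> : (\int[mu]_(x in `]0%R, 1%R[) ((1 - x) `^ (e - 1))%:E =
    \int[pushforward mu (-%R : measurableTypeR R -> measurableTypeR R)]_(x in `]0%R, 1%R[)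
       ((1 - x) `^ (e - 1))%:E)%E.
  apply: eq_measure_integral => A mA _; exact/esym/lebesgue_measureN.
rewrite ge0_integral_pushforward//; last 2 first.
  by apply/measurable_EFinP; exact: measurable_funTS.
  by move=> x _; rewrite lee_fin powR_ge0.
rewrite opp_preimage_itvbndbnd/= oppr0 integral_itv01 ?ltrN10//; last first.
  apply/measurable_EFinP => /=.
  by apply: (measurableT_comp mf); exact: oppr_measurable.
rewrite opprK add0r mul1e.
have /integrableP[_] := integrable_powR01 e0.
apply: le_lt_trans; rewrite le_eqVlt; apply/orP; left; apply/eqP.
apply: eq_integral => x _ /=; rewrite ger0_norm ?powR_ge0//.
by congr (_ `^ _)%:E; ring.
Qed.

(** A power is monotone, increasing or decreasing with the sign of [e], so one of its values at 1/2
    and 1 is a bound; the sum covers both signs. *)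
Lemma powR_half_le (e z : R) : 2^-1 <= z -> z <= 1 -> z `^ e <= 2^-1 `^ e + 1.
Proof.
move=> z2 z1; have z0 : 0 < z by apply: lt_le_trans z2; rewrite invr_gt0.
have [e0|e0] := leP 0 e.
  apply: ler_wpDl; first exact: powR_ge0.
  rewrite -[leRHS](_ : 1 `^ e = 1); last by rewrite powR1.
  by apply: ge0_ler_powR => //; rewrite nnegrE ?ltW.
rewrite (le_trans (_ : _ <= 2^-1 `^ e))// ?lerDl//.
rewrite -[e]opprK !(powRN _ (- e)) lef_pV2 ?posrE ?powR_gt0 ?invr_gt0//.
apply: ge0_ler_powR => //; rewrite ?nnegrE ?oppr_ge0 ?invr_ge0 ?ltW//.
Qed.

(** On each half of ]0, 1[ only one factor can be singular; the other one is bounded by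
    [powR_half_le]. *)
Lemma integrable_beta (x y : R) : 0 < x -> 0 < y ->
  mu.-integrable `]0, 1[ (EFin \o (fun z => z `^ (x - 1) * (1 - z) `^ (y - 1))).
Proof.
move=> x0 y0.
pose c (e : R) := 2^-1 `^ (e - 1) + 1.
have c0 e : 0 <= c e by rewrite addr_ge0// powR_ge0.
apply: (@integrable_dominated _ _ _ mu _ (fun z : R =>
   c x * (1 - z) `^ (y - 1) + c y * z `^ (x - 1))) => //.
- apply: integrableD_fin => //; apply: integrableZl_fin => //.
    exact: integrable_onem_powR01.
  exact: integrable_powR01.
- apply: measurable_funM; first exact: measurable_powR_itv.
  apply: measurable_funTS; apply: (measurableT_comp (measurable_powR _)).
  exact: measurable_funB.
- move=> z /=; rewrite in_itv/= => /andP[z0 z1].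
  rewrite ger0_norm ?mulr_ge0 ?powR_ge0//.
  have [zh|zh] := leP 2^-1 z.
    apply: ler_wpDr; first by rewrite mulr_ge0 ?powR_ge0.
    by rewrite ler_wpM2r ?powR_ge0// powR_half_le// ltW.
  apply: ler_wpDl; first by rewrite mulr_ge0 ?powR_ge0.
  rewrite mulrC ler_wpM2r ?powR_ge0// powR_half_le//; last lra.
  by rewrite lerBrDr; move: zh; lra.
Qed.

End integrability.

(** * Fubini's theorem on a rectangle *)

Section fubini_on_rectangles.
Context d1 d2 (T1 : measurableType d1) (T2 : measurableType d2) {R : realType}
  (m1 : {sigma_finite_measure set T1 -> \bar R})
  (m2 : {sigma_finite_measure set T2 -> \bar R}).

(** Extend [f] by 0 off the rectangle. By Tonelli, the integrable bound [g] on the inner integrals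
    of |f| makes the extension integrable on the product. The integrability of the sections is what
    lets finite-valued integrals be read as extended ones. *)
Lemma fubini_on (D : set T1) (E : set T2) (f : T1 * T2 -> R) (g : T2 -> R) :
  measurable D -> measurable E -> measurable_fun setT f ->
  (forall x, D x -> m2.-integrable E (EFin \o (fun y => f (x, y)))) ->
  (forall y, E y -> m1.-integrable D (EFin \o (fun x => f (x, y)))) ->
  m2.-integrable E (EFin \o g) ->
  (forall y, E y -> \int[m1]_(x in D) `|f (x, y)| <= g y) ->
  m1.-integrable D (EFin \o (fun x => \int[m2]_(y in E) f (x, y))) /\
  \int[m1]_(x in D) \int[m2]_(y in E) f (x, y) =
  \int[m2]_(y in E) \int[m1]_(x in D) f (x, y).
Proof.
move=> mD mE mf if2 if1 ig fg.
pose F := (EFin \o f) \_ (D `*` E).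
have mF : measurable_fun setT F.
  apply/(measurable_restrictT _ _).1; first exact: measurableX.
  by apply: measurable_funTS; exact/measurable_EFinP.
have FE1 x : fubini_F m2 F x = ((EFin \o (fun x => \int[m2]_(y in E) f (x, y))) \_ D) x.
  rewrite /fubini_F patchE; case: ifPn => [/set_mem Dx|/negP nDx].
    rewrite /= /Rintegral fineK; last exact: integrable_fin_num (if2 _ Dx).
    rewrite [RHS]integral_mkcond; apply: eq_integral => y _.
    by rewrite /F !patchE in_setX mem_set.
  apply: integral0_eq => y _; rewrite /F patchE in_setX.
  by case: ifPn => // /andP[/nDx].
have FE2 y : fubini_G m1 F y = ((EFin \o (fun y => \int[m1]_(x in D) f (x, y))) \_ E) y.
  rewrite /fubini_G patchE; case: ifPn => [/set_mem Ey|/negP nEy].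
    rewrite /= /Rintegral fineK; last exact: integrable_fin_num (if1 _ Ey).
    rewrite [RHS]integral_mkcond; apply: eq_integral => x _.
    by rewrite /F !patchE in_setX (mem_set Ey) andbT.
  apply: integral0_eq => x _; rewrite /F patchE in_setX.
  by case: ifPn => // /andP[_ /nEy].
have iF : (m1 \x m2)%E.-integrable setT F.
  apply/integrable21ltyP => //.
  have /integrableP[_] := ig; apply: le_lt_trans.
  rewrite [leRHS]integral_mkcond; apply: ge0_le_integral => //.
  - by move=> y _; exact: integral_ge0.
  - apply: (@measurable_fun_fubini_tonelli_G _ _ _ _ _ m1 (abse \o F)) => //.
      exact: measurableT_comp.
    by move=> z; exact: abse_ge0.
  - apply/(measurable_restrictT _ _).1 => //.
    by apply: measurableT_comp => //; exact: measurable_int ig.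
  move=> y _; rewrite patchE; case: ifPn => [/set_mem Ey|/negP nEy].
    apply: (@le_trans _ _ (g y)%:E); last by rewrite /= lee_fin ler_norm.
    have := fg _ Ey; rewrite -lee_fin; apply: le_trans.
    rewrite /Rintegral fineK; last first.
      apply: integrable_fin_num => //=; have := integrable_abse (if1 _ Ey).
      exact.
    rewrite [leRHS]integral_mkcond le_eqVlt; apply/orP; left; apply/eqP.
    apply: eq_integral => x _; rewrite /F !patchE in_setX (mem_set Ey) andbT.
    by case: ifPn => //=; rewrite ?normr0.
  rewrite integral0_eq// => x _; rewrite /F patchE in_setX.
  by case: ifPn => [/andP[_ /nEy]//|]; rewrite /= normr0.
split.
  apply/integrable_mkcond => //.
  by have := integrable_fubini_F iF; apply: eq_integrable => // x _; rewrite FE1.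
have := integral12_prod_meas1 iF; rewrite -(integral21_prod_meas1 iF).
under eq_integral do rewrite FE1.
under [in RHS]eq_integral do rewrite FE2.
by rewrite -!integral_mkcond /Rintegral => ->.
Qed.
End fubini_on_rectangles.

(** * Parameter integrals and shifted powers *)

Section continuity_tools.
Context {R : realType}.

Lemma gt0_powRD (x r s : R) : 0 < x -> x `^ (r + s) = x `^ r * x `^ s.
Proof. by move=> x0; rewrite powRD// (gt_eqF x0) implybT. Qed.

(** Writing 1 / f as f (f ^ 2) ^ (-1) reduces inversion to a real power with nonnegative base; where
    f vanishes both sides are 0. *)
Lemma measurable_invr d (X : measurableType d) (f : X -> R) :
  measurable_fun setT f -> measurable_fun setT (fun x => (f x)^-1).
Proof.
move=> mf; rewrite (_ : (fun x => _) = (fun x => f x * (f x ^+ 2) `^ (-1))).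
  apply: measurable_funM => //; apply: (measurableT_comp (measurable_powR (-1))).
  exact: measurable_funX.
apply/funext => x; rewrite powR_inv1 ?sqr_ge0// expr2 invfM mulrA.
have [->|fx0] := eqVneq (f x) 0; first by rewrite invr0 mulr0.
by rewrite mulfV// mul1r.
Qed.

Implicit Types L x : R.

(* [clamp L] retracts the line onto [0, L]; it extends functions on [0, L] to the line. *)
Definition clamp L x : R := Num.max 0 (Num.min x L).

Lemma clamp_ge0 L x : 0 <= clamp L x.
Proof. by rewrite /clamp le_max lexx. Qed.

Lemma clamp_le L x : 0 <= L -> clamp L x <= L.
Proof. by move=> L0; rewrite /clamp ge_max L0 ge_min lexx orbT. Qed.

Lemma clamp_id L x : 0 <= x <= L -> clamp L x = x.
Proof. by case/andP => x0 xL; rewrite /clamp (min_idPl xL) (max_idPr x0). Qed.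

Lemma continuous_clamp L : continuous (clamp L).
Proof.
move=> x; apply: (@continuous_max _ _ (cst 0) (fun x => Num.min x L)).
  exact: cvg_cst.
by apply: (@continuous_min _ _ id (cst L)); [exact: cvg_id|exact: cvg_cst].
Qed.

(** Used for the factor (T - v) ^ a, which must stay continuous at its zero v = T. At 0 the modulus
    of continuity is c ^ (1 / e). *)
Lemma continuous_max0_powR (e : R) : 0 < e -> continuous (fun x : R => Num.max 0 x `^ e).
Proof.
move=> e0 x; suff : (Num.max 0 y) `^ e @[y --> x] --> (Num.max 0 x) `^ e by [].
have [x0|x0|->] := ltgtP x 0; rewrite ?maxxx.
- have cst0 : (fun=> (0 : R) `^ e) @ x --> (0 : R) `^ e by exact: cvg_cst.
  apply: cvg_trans cst0.
  apply: near_eq_cvg; near=> y; rewrite (max_idPl _)//.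
  by apply: ltW; near: y; exact: lt_nbhsl.
- apply: cvg_trans (cvg_powR (a := e) x0).
  apply: near_eq_cvg; near=> y; rewrite (max_idPr _)//.
  by apply: ltW; near: y; exact: lt_nbhsr.
- rewrite powR0 ?gt_eqF//; apply/cvgrPdist_le => c c0.
  near=> y; rewrite sub0r normrN ger0_norm ?powR_ge0//.
  have -> : c = (c `^ e^-1) `^ e by rewrite -powRrM mulVf ?gt_eqF// powRr1// ltW.
  apply: ge0_ler_powR; rewrite ?nnegrE ?powR_ge0 ?le_max ?lexx ?(ltW e0)//.
  rewrite ge_max powR_ge0/=; apply: ltW; near: y; apply: lt_nbhsl.
  by rewrite powR_gt0.
Unshelve. all: end_near. Qed.

Lemma continuous_Rintegral d (Y : measurableType d) (mu : {measure set Y -> \bar R})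
    (f : R -> Y -> R) (B : set Y) (g : Y -> R) :
  measurable B -> (forall x, measurable_fun B (f x)) ->
  (forall y, B y -> continuous (f^~ y)) -> mu.-integrable B (EFin \o g) ->
  (forall x y, B y -> `|f x y| <= g y) ->
  continuous (fun x => \int[mu]_(y in B) f x y).
Proof.
move=> mB mf cf ig fg x.
apply: (@continuity_under_integral _ _ _ mu f B mB (x - 1) (x + 1) _ _ g) => //.
- by move=> z _; apply: (integrable_dominated mB ig) => // y; exact: fg.
- by apply: aeW => y By z _; exact: cf.
- by move=> z _; apply: aeW => y; exact: fg.
- by rewrite inE/= in_itv/= gtrBl ltrDl ltr01.
Qed.

Notation mu := (@lebesgue_measure R).

Lemma measurable_shift_powR (e v : R) (D : set R) :
  measurable_fun D (fun s : R => (s - v) `^ e).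
Proof.
apply: measurable_funTS; apply: (measurableT_comp (measurable_powR e)).
exact: measurable_funB.
Qed.

Lemma integrable_shift_powR (e v w : R) : 0 < e ->
  mu.-integrable `]v, w[ (EFin \o (fun s => (s - v) `^ (e - 1))).
Proof.
move=> e0; have [wv|vw] := leP w v.
  by rewrite set_itv_ge ?bnd_simp -?leNgt//; exact: integrable_set0.
apply: integrable_itv01 => //; first exact: measurable_shift_powR.
apply: (@eq_integrable _ _ _ mu _ _ (EFin \o (fun z => (w - v) `^ (e - 1) * z `^ (e - 1)))) => //;
  last by apply: integrableZl_fin => //; exact: integrable_powR01.
move=> z; rewrite inE/= in_itv/= => /andP[z0 _].
by rewrite [in RHS]addrAC subrr add0r powRM// ltW// subr_gt0.
Qed.

Lemma Rintegral_shift_powR (e v w : R) : 0 < e -> v <= w ->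
  \int[mu]_(s in `]v, w[) (s - v) `^ (e - 1) =
  (w - v) `^ e * \int[mu]_(z in `]0, 1[) z `^ (e - 1).
Proof.
move=> e0; rewrite le_eqVlt => /predU1P[->|vw].
  rewrite set_itv_ge ?bnd_simp -?leNgt// Rintegral_set0.
  by rewrite subrr powR0 ?mul0r// gt_eqF.
have wv0 : 0 < w - v by rewrite subr_gt0.
rewrite (Rintegral_itv01 vw); last exact: measurable_shift_powR.
rewrite (@eq_Rintegral _ _ _ mu _ (fun z => (w - v) `^ (e - 1) * z `^ (e - 1))); last first.
  move=> z; rewrite inE/= in_itv/= => /andP[z0 _].
  by rewrite addrAC subrr add0r powRM ?(ltW z0) ?(ltW wv0).
by rewrite (RintegralZl _ _ (integrable_powR01 e0))// mulrA mulr_powRB1// ltW.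
Qed.

Lemma le0_ger_powR (e x y : R) : e <= 0 -> 0 < x -> x <= y -> y `^ e <= x `^ e.
Proof.
move=> e0 x0 xy; have y0 : 0 < y by exact: lt_le_trans xy.
rewrite -[e]opprK !(powRN _ (- e)) lef_pV2 ?posrE ?powR_gt0//.
by apply: ge0_ler_powR; rewrite ?nnegrE ?oppr_ge0 ?(ltW x0) ?(ltW y0).
Qed.

(** Compare [x] with [del]: below it, half of the exponent is traded for a small coefficient and
    what remains is still integrable; above it, the power is bounded. All smallness in the a priori
    estimate comes from here. *)
Lemma powR_split_le (e del x : R) : 0 < e -> e < 1 -> 0 < del -> 0 < x ->
  x `^ (e - 1) <= del `^ (e / 2) * x `^ (e / 2 - 1) + del `^ (e - 1).
Proof.
move=> e0 e1 d0 x0; have [xd|dx] := leP x del.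
  apply: ler_wpDr; first exact: powR_ge0.
  rewrite (_ : e - 1 = e / 2 + (e / 2 - 1)); last by field.
  rewrite [x `^ (e / 2 + _)]gt0_powRD// ler_wpM2r ?powR_ge0//.
  by apply: ge0_ler_powR; rewrite ?nnegrE ?(ltW x0) ?(ltW d0) ?divr_ge0 ?(ltW e0).
apply: ler_wpDl; first by rewrite mulr_ge0 ?powR_ge0.
by apply: le0_ger_powR; rewrite ?(ltW dx)// subr_le0 ltW.
Qed.

End continuity_tools.

(** * The homogeneous weakly singular kernel N *)

Section weakly_singular_kernel.
Context {R : realType} (a C : R) (phi : R -> R).
Notation mu := (@lebesgue_measure R).
Implicit Types s v u : R.

(* This is N(s, v) when [phi] is the function [profile] below; [v = 0] is included because
   kappa(s, 0) is a multiple of N(s, 0). *)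
Definition ker s v : R :=
  if (0 <= v) && (v < s) then s `^ a * (s - v) `^ (a - 1) * phi (v / s) else 0.

Lemma ker_eq0 s v : s <= v -> ker s v = 0.
Proof. by move=> sv; rewrite /ker (leNgt s v) in sv *; rewrite (negbTE sv) andbF. Qed.

Lemma kerE s v : 0 <= v -> v < s ->
  ker s v = s `^ a * (s - v) `^ (a - 1) * phi (v / s).
Proof. by move=> v0 vs; rewrite /ker v0 vs. Qed.

Lemma kerM (k : R) s v : 0 < k -> ker (k * s) (k * v) = k `^ (2 * a - 1) * ker s v.
Proof.
move=> k0; rewrite /ker pmulr_rge0// ltr_pM2l//; case: ifP => [/andP[v0 vs]|]; last by rewrite mulr0.
have s0 : 0 < s by exact: le_lt_trans vs.
rewrite -mulrBr !powRM ?(ltW k0) ?(ltW s0) ?subr_ge0 ?(ltW vs)//.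
rewrite -mulf_div divff ?gt_eqF// mul1r.
rewrite (_ : 2 * a - 1 = a + (a - 1)); last by ring.
by rewrite [k `^ (a + (a - 1))]gt0_powRD//; ring.
Qed.

Context (a0 : 0 < a) (a1 : a < 1) (phi_cont : continuous phi)
  (phi_ge0 : forall y, 0 <= phi y) (phi_le : forall y, phi y <= C).

Let C0 : 0 <= C. Proof. exact: le_trans (phi_ge0 0) (phi_le 0). Qed.

Lemma ker_ge0 s v : 0 <= ker s v.
Proof. by rewrite /ker; case: ifP => // _; rewrite !mulr_ge0 ?powR_ge0. Qed.

Lemma ker_le L s v : v < s -> s <= L -> ker s v <= C * L `^ a * (s - v) `^ (a - 1).
Proof.
move=> vs sL; rewrite /ker; case: ifP => [/andP[v0 _]|_]; last first.
  by rewrite !mulr_ge0// powR_ge0.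
have s0 : 0 < s by exact: le_lt_trans vs.
rewrite [leRHS](_ : _ = L `^ a * (s - v) `^ (a - 1) * C); last by ring.
apply: ler_pM => //; first by rewrite mulr_ge0 ?powR_ge0.
rewrite ler_wpM2r ?powR_ge0//.
by apply: ge0_ler_powR; rewrite ?nnegrE ?(ltW a0) ?(ltW s0)// (le_trans (ltW s0)).
Qed.

Lemma measurable_ker d (X : measurableType d) (f g : X -> R) :
  measurable_fun setT f -> measurable_fun setT g ->
  measurable_fun setT (fun x => ker (f x) (g x)).
Proof.
move=> mf mg; apply: measurable_fun_ifT.
- apply: measurable_and; first exact: measurable_fun_ler.
  exact: measurable_fun_ltr.
- apply: measurable_funM; first apply: measurable_funM.
  + exact: (measurableT_comp (measurable_powR a)).
  + by apply: (measurableT_comp (measurable_powR (a - 1))); exact: measurable_funB.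
  + apply: (measurableT_comp (continuous_measurable_fun phi_cont)).
    by apply: measurable_funM => //; exact: measurable_invr.
- exact: measurable_cst.
Qed.

End weakly_singular_kernel.

(** * The operator G: bounds and continuity *)

Section volterra_operator.
Context {R : realType} (a C T : R) (phi : R -> R).
Notation mu := (@lebesgue_measure R).
Notation N := (ker a phi).
Implicit Types (g h : R -> R) (s u v z M : R).

(* The operator G. *)
Definition volterra h v : R := \int[mu]_(s in `]v, T[) (N s v * h s).

Context (a0 : 0 < a) (a1 : a < 1) (phi_cont : continuous phi)
  (phi_ge0 : forall y, 0 <= phi y) (phi_le : forall y, phi y <= C) (T0 : 0 < T).

Let C0 : 0 <= C. Proof. exact: le_trans (phi_ge0 0) (phi_le 0). Qed.
Let CT0 : 0 <= C * T `^ a. Proof. by rewrite mulr_ge0// powR_ge0. Qed.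

Lemma measurable_kerl (D : set (measurableTypeR R)) v :
  measurable_fun D (fun s : measurableTypeR R => N s v).
Proof. by apply: measurable_funTS; exact: measurable_ker. Qed.

Lemma measurable_kerr (D : set (measurableTypeR R)) s :
  measurable_fun D (fun v : measurableTypeR R => N s v).
Proof. by apply: measurable_funTS; exact: measurable_ker. Qed.

Lemma measurable_volterra_integrand (D : set (measurableTypeR R)) h v :
  measurable_fun setT h -> measurable_fun D (fun s : measurableTypeR R => N s v * h s).
Proof.
move=> mh; apply: measurable_funM; first exact: measurable_kerl.
exact: measurable_funTS.
Qed.

Lemma volterra_integrand_le h v s M : (forall x, `|h x| <= M) -> v < s -> s < T ->
  `|N s v * h s| <= C * T `^ a * M * (s - v) `^ (a - 1).
Proof.
move=> hM vs sT; rewrite normrM ger0_norm ?ker_ge0//.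
rewrite [leRHS](_ : _ = C * T `^ a * (s - v) `^ (a - 1) * M); last by ring.
apply: ler_pM => //; first exact: ker_ge0.
by apply: ker_le => //; exact: ltW.
Qed.

Lemma integrable_volterra h v M : measurable_fun setT h -> (forall x, `|h x| <= M) ->
  mu.-integrable `]v, T[ (EFin \o (fun s => N s v * h s)).
Proof.
move=> mh hM.
apply: (@integrable_dominated _ _ _ mu _
  (fun s => C * T `^ a * M * (s - v) `^ (a - 1))) => //.
- by apply: integrableZl_fin => //; exact: integrable_shift_powR.
- exact: measurable_volterra_integrand.
- move=> s /=; rewrite in_itv/= => /andP[vs sT].
  exact: volterra_integrand_le.
Qed.

Lemma integrable_bounded_itv h x y M : measurable_fun setT h -> (forall x, `|h x| <= M) ->
  mu.-integrable `]x, y[ (EFin \o h).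
Proof.
move=> mh hM; apply: (@integrable_dominated _ _ _ mu _ (fun=> M)) => //.
  exact: integrable_cst_itv.
exact: measurable_funTS.
Qed.

Lemma le_Rintegral_subset (D E : set (measurableTypeR R)) h : measurable D -> measurable E ->
  mu.-integrable E (EFin \o h) -> (forall x, E x -> 0 <= h x) -> D `<=` E ->
  \int[mu]_(x in D) h x <= \int[mu]_(x in E) h x.
Proof.
move=> mD mE ih h0 DE; apply: fine_le.
- by apply: integrable_fin_num => //; exact: integrableS ih.
- exact: integrable_fin_num.
- apply: ge0_subset_integral => //.
  by have /integrableP[] := ih.
Qed.

(** [powR_split_le] is applied to (s - v) ^ (a - 1): the singular part is paired with the sup bound
    [M], the bounded part with the L^1 norm. A small [del] makes the coefficient of [M] small; [del]
    = 1 already gives boundedness. *)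
Lemma volterra_le h v M del : measurable_fun setT h -> (forall x, `|h x| <= M) ->
  0 < del -> 0 <= v <= T ->
  `|volterra h v| <=
  C * T `^ a * (del `^ (a / 2) * T `^ (a / 2) *
     \int[mu]_(z in `]0, 1[) z `^ (a / 2 - 1)) * M +
  C * T `^ a * del `^ (a - 1) * \int[mu]_(s in `]0, T[) `|h s|.
Proof.
move=> mh hM d0 /andP[v0 vT].
have M0 : 0 <= M by exact: le_trans (normr_ge0 (h 0)) (hM 0).
have a20 : 0 < a / 2 by rewrite divr_gt0.
have mnh : measurable_fun setT (fun x => `|h x|) by exact: measurableT_comp.
have hnM x : `| `|h x| | <= M by rewrite normr_id.
have i1 : mu.-integrable `]v, T[
    (EFin \o (fun s => C * T `^ a * M * del `^ (a / 2) * (s - v) `^ (a / 2 - 1))).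
  by apply: integrableZl_fin => //; exact: integrable_shift_powR.
have i2 : mu.-integrable `]v, T[ (EFin \o (fun s => C * T `^ a * del `^ (a - 1) * `|h s|)).
  by apply: integrableZl_fin => //; exact: integrable_bounded_itv mnh hnM.
apply: (@le_trans _ _ (\int[mu]_(s in `]v, T[)
   (C * T `^ a * M * del `^ (a / 2) * (s - v) `^ (a / 2 - 1) +
    C * T `^ a * del `^ (a - 1) * `|h s|))).
  apply: Rintegral_dominated => //.
  - exact: integrableD_fin.
  - exact: measurable_volterra_integrand.
  - move=> s /=; rewrite in_itv/= => /andP[vs sT].
    rewrite normrM ger0_norm ?ker_ge0//.
    apply: (@le_trans _ _ (C * T `^ a * (s - v) `^ (a - 1) * `|h s|)).
      by rewrite ler_wpM2r//; apply: ker_le => //; exact: ltW.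
    have sv0 : 0 < s - v by rewrite subr_gt0.
    have := powR_split_le a0 a1 d0 sv0 => /(ler_wpM2l CT0) /(ler_wpM2r (normr_ge0 (h s))).
    move=> /le_trans; apply; rewrite mulrDr mulrDl lerD2r.
    rewrite [leRHS](_ : _ = C * T `^ a * (del `^ (a / 2) * (s - v) `^ (a / 2 - 1)) * M);
      last by ring.
    by rewrite ler_wpM2l// !mulr_ge0 ?powR_ge0.
rewrite RintegralD// lerD//.
  rewrite RintegralZl//; last exact: integrable_shift_powR.
  rewrite Rintegral_shift_powR//.
  set J := \int[mu]_(_ in _) _.
  have J0 : 0 <= J by apply: Rintegral_ge0 => z _; exact: powR_ge0.
  rewrite [leRHS](_ : _ = C * T `^ a * M * del `^ (a / 2) * (T `^ (a / 2) * J)); last by ring.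
  rewrite ler_wpM2l ?mulr_ge0 ?powR_ge0// ler_wpM2r//.
  apply: ge0_ler_powR; rewrite ?nnegrE ?(ltW a20) ?(ltW T0) ?subr_ge0//.
  by rewrite gerBl.
rewrite RintegralZl//; last exact: integrable_bounded_itv mnh hnM.
rewrite ler_wpM2l ?mulr_ge0 ?powR_ge0//.
apply: le_Rintegral_subset => //; first exact: integrable_bounded_itv mnh hnM.
by move=> x /=; rewrite !in_itv/= => /andP[vx ->]; rewrite (le_lt_trans v0 vx).
Qed.

Lemma volterraB g h v M M' : measurable_fun setT g -> measurable_fun setT h ->
  (forall x, `|g x| <= M) -> (forall x, `|h x| <= M') ->
  volterra (fun x => g x - h x) v = volterra g v - volterra h v.
Proof.
move=> mg mh gM hM'; rewrite /volterra.
rewrite -RintegralB//; last 2 first.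
- exact: integrable_volterra mg gM.
- exact: integrable_volterra mh hM'.
by apply: eq_Rintegral => s _; rewrite mulrBr.
Qed.

(** What remains of N(s, v) h(s) after s = v + (T - v) z once (T - v) ^ (a - 1) is taken out:
    neither the domain nor the singularity z ^ (a - 1) moves with [v]. *)
Let integrand h v z : R :=
  z `^ (a - 1) * ((v + (T - v) * z) `^ a * phi (v / (v + (T - v) * z)) * h (v + (T - v) * z)).

Let S_gt0 v z : 0 <= v <= T -> 0 < z < 1 -> 0 < v + (T - v) * z.
Proof.
move=> /andP[v0 vT] /andP[z0 z1]; apply: (@lt_le_trans _ _ (T * z)); first exact: mulr_gt0.
have : 0 <= v * (1 - z) by rewrite mulr_ge0// subr_ge0 ltW.
lra.
Qed.

Let S_le v z : 0 <= v <= T -> 0 < z < 1 -> v + (T - v) * z <= T.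
Proof.
move=> /andP[v0 vT] /andP[z0 z1].
have : 0 <= (T - v) * (1 - z) by rewrite mulr_ge0// subr_ge0// ltW.
lra.
Qed.

Let integrand_le h v z M : (forall x, `|h x| <= M) -> 0 <= v <= T -> 0 < z < 1 ->
  `|integrand h v z| <= T `^ a * C * M * z `^ (a - 1).
Proof.
move=> hM vT z01; rewrite /integrand mulrC normrM [X in _ * X]ger0_norm ?powR_ge0//.
rewrite ler_wpM2r ?powR_ge0// normrM [X in X * _]ger0_norm ?mulr_ge0 ?powR_ge0//.
apply: ler_pM => //; first by rewrite mulr_ge0 ?powR_ge0.
apply: ler_pM => //; first exact: powR_ge0.
by apply: ge0_ler_powR; rewrite ?nnegrE ?(ltW a0) ?(ltW T0) ?S_le// ltW// S_gt0.
Qed.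

Let measurable_integrand (D : set (measurableTypeR R)) h v : measurable_fun setT h ->
  measurable_fun D (fun z : measurableTypeR R => integrand h v z).
Proof.
move=> mh; apply: measurable_funTS.
have mS := measurable_affine v (T - v).
apply: measurable_funM; first exact: measurable_powR.
apply: measurable_funM; last exact: (measurableT_comp mh mS).
apply: measurable_funM; first exact: (measurableT_comp (measurable_powR a) mS).
apply: (measurableT_comp (continuous_measurable_fun phi_cont)).
apply: measurable_funM => //.
exact: measurable_invr.
Qed.

Lemma volterra_scaled h v M : measurable_fun setT h -> (forall x, `|h x| <= M) ->
  0 <= v <= T ->
  volterra h v = (T - v) `^ a * \int[mu]_(z in `]0, 1[) integrand h v z.
Proof.
move=> mh hM v0T; have /andP[v0 vT] := v0T.
(* At v = T the domain is empty and 0 ^ a = 0, because a > 0. *)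
move: vT; rewrite le_eqVlt => /predU1P[->|vT].
  rewrite /volterra set_itv_ge ?bnd_simp -?leNgt// Rintegral_set0.
  by rewrite subrr powR0 ?mul0r// gt_eqF.
have Tv0 : 0 < T - v by rewrite subr_gt0.
rewrite /volterra (Rintegral_itv01 vT); last exact: measurable_volterra_integrand.
rewrite (@eq_Rintegral _ _ _ mu _ (fun z => (T - v) `^ (a - 1) * integrand h v z)); last first.
  move=> z; rewrite inE/= in_itv/= => /andP[z0 z1].
  rewrite kerE//; last by rewrite ltrDl mulr_gt0.
  have -> : v + (T - v) * z - v = (T - v) * z by ring.
  by rewrite powRM ?(ltW z0) ?(ltW Tv0)// /integrand; ring.
have ii : mu.-integrable `]0, 1[ (EFin \o integrand h v).
  apply: (@integrable_dominated _ _ _ mu _ (fun z => T `^ a * C * M * z `^ (a - 1))) => //.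
  - by apply: integrableZl_fin => //; exact: integrable_powR01.
  - exact: measurable_integrand.
  - by move=> z /=; rewrite in_itv/=; exact: integrand_le.
by rewrite (RintegralZl _ _ ii)// mulrA mulr_powRB1// ltW.
Qed.

(** In the form of [volterra_scaled] the integrand is continuous in [v] and dominated by a fixed
    multiple of z ^ (a - 1). *)
Lemma continuous_volterra h : bounded_continuous h ->
  continuous (fun v => volterra h (clamp T v)).
Proof.
move=> [ch [M hM]].
have mh : measurable_fun setT h by exact: continuous_measurable_fun.
have c0T v : 0 <= clamp T v <= T by rewrite clamp_ge0 clamp_le// ltW.
rewrite (_ : (fun v => _) = (fun v => Num.max 0 (T - clamp T v) `^ a *
    \int[mu]_(z in `]0, 1[) integrand h (clamp T v) z)); last first.
  apply/funext => v; rewrite (volterra_scaled mh hM)//.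
  by rewrite (max_idPr _)// subr_ge0; case/andP: (c0T v).
have cc : continuous (clamp T) by exact: continuous_clamp.
move=> v; apply: cvgM.
  apply: (@continuous_comp _ _ _ (fun v => T - clamp T v) (fun x => Num.max 0 x `^ a)).
    by apply: cvgB; [exact: cvg_cst|exact: cc].
  exact: continuous_max0_powR.
move: v; apply: (@continuous_Rintegral _ _ _ mu _ _ (fun z => T `^ a * C * M * z `^ (a - 1))) => //.
- by move=> v; exact: measurable_integrand.
- move=> z /=; rewrite in_itv/= => z01 v.
  have S0 := S_gt0 (c0T v) z01.
  have cS : {for v, continuous (fun v => clamp T v + (T - clamp T v) * z)}.
    apply: cvgD; first exact: cc.
    apply: cvgM; last exact: cvg_cst.
    by apply: cvgB; [exact: cvg_cst|exact: cc].
  apply: cvgM; first exact: cvg_cst.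
  apply: cvgM; first apply: cvgM.
  + apply: (@continuous_comp _ _ _ (fun v => clamp T v + (T - clamp T v) * z) (fun x => x `^ a)) => //.
    exact: cvg_powR.
  + apply: (@continuous_comp _ _ _ (fun v => clamp T v / (clamp T v + (T - clamp T v) * z)) phi) => //.
      by apply: cvgM; [exact: cc|apply: cvgV; rewrite ?gt_eqF].
    exact: phi_cont.
  + apply: (@continuous_comp _ _ _ (fun v => clamp T v + (T - clamp T v) * z) h) => //.
    exact: ch.
- by apply: integrableZl_fin => //; exact: integrable_powR01.
- by move=> v z /=; rewrite in_itv/=; exact: integrand_le.
Qed.

End volterra_operator.

(** * The operator A on bounded continuous functions *)

Section kernel_operator.
Context {R : realType} (a C T r : R) (phi : R -> R).
Notation mu := (@lebesgue_measure R).
Notation N := (ker a phi).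
Notation G := (volterra a T phi).
Implicit Types (g h : R -> R) (s u v y M : R).

Definition mker y : R := y `^ (- r) * N 1 y.

(* The operator A, with [u] and [u y] clamped so that A h is defined on the whole line. *)
Definition kernel_op h u : R :=
  \int[mu]_(y in `]0, 1[) (mker y * G h (clamp T (clamp T u * y))).

Context (a0 : 0 < a) (a1 : a < 1) (phi_cont : continuous phi)
  (phi_ge0 : forall y, 0 <= phi y) (phi_le : forall y, phi y <= C) (T0 : 0 < T)
  (r1 : r < 1).

Let c0T u : 0 <= clamp T u <= T.
Proof. by rewrite clamp_ge0 clamp_le// ltW. Qed.

Lemma mker_ge0 y : 0 <= mker y.
Proof. by rewrite mulr_ge0 ?powR_ge0// ker_ge0. Qed.

Lemma measurable_mker (D : set (measurableTypeR R)) :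
  measurable_fun D (mker : measurableTypeR R -> R).
Proof.
apply: measurable_funM; first exact: measurable_powR_itv.
exact: (measurable_kerr _ phi_cont).
Qed.

(** It is dominated by a multiple of the beta density y ^ (- r) (1 - y) ^ (a - 1), with r < 1 and a
    > 0. *)
Lemma integrable_mker : mu.-integrable `]0, 1[ (EFin \o mker).
Proof.
apply: (@integrable_dominated _ _ _ mu _
  (fun y => C * (y `^ (1 - r - 1) * (1 - y) `^ (a - 1)))) => //.
- by apply: integrableZl_fin => //; apply: integrable_beta => //; rewrite subr_gt0.
- exact: measurable_mker.
- move=> y /=; rewrite in_itv/= => /andP[y0 y1].
  rewrite ger0_norm ?mker_ge0// /mker kerE ?(ltW y0)// powR1 mul1r divr1.
  rewrite (_ : 1 - r - 1 = - r); last by ring.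
  by rewrite mulrA mulrC ler_wpM2r// mulr_ge0 ?powR_ge0.
Qed.

Lemma integrable_mkerM g M : measurable_fun setT g -> (forall x, `|g x| <= M) ->
  mu.-integrable `]0, 1[ (EFin \o (fun y => mker y * g y)).
Proof.
move=> mg gM; apply: (@integrable_dominated _ _ _ mu _ (fun y => M * mker y)) => //.
- by apply: integrableZl_fin => //; exact: integrable_mker.
- by apply: measurable_funM; [exact: measurable_mker|exact: measurable_funTS].
- move=> y _; rewrite normrM ger0_norm ?mker_ge0// mulrC.
  by rewrite ler_wpM2r// mker_ge0.
Qed.

(** Under v = u y the differential gives u, the weight u ^ (- r) and homogeneity u ^ (2 a - 1);
    these multiply to u ^ (2 a - r). *)
Lemma mker_subst g u M : measurable_fun setT g -> (forall x, `|g x| <= M) -> 0 < u ->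
  \int[mu]_(v in `]0, u[) (v `^ (- r) * N u v * g v) =
  u `^ (2 * a - r) * \int[mu]_(y in `]0, 1[) (mker y * g (u * y)).
Proof.
move=> mg gM u0.
have mgu : measurable_fun setT (fun y => g (u * y)).
  by apply: (measurableT_comp mg); exact: measurable_funM.
rewrite (Rintegral_itv01 u0); last first.
  apply: measurable_funM; last exact: measurable_funTS.
  apply: measurable_funM; first exact: measurable_powR_itv.
  exact: (measurable_kerr _ phi_cont).
rewrite subr0 (@eq_Rintegral _ _ _ mu _
    (fun z => u `^ (- r) * u `^ (2 * a - 1) * (mker z * g (u * z)))); last first.
  move=> z; rewrite inE/= in_itv/= => /andP[z0 z1]; rewrite add0r /mker.
  by rewrite powRM ?(ltW u0) ?(ltW z0)// -{1}[u in N u]mulr1 kerM//; ring.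
rewrite (RintegralZl _ _ (integrable_mkerM mgu (fun x => gM (u * x))))//.
rewrite !mulrA; congr (_ * _).
rewrite (_ : 2 * a - r = 1 + (- r) + (2 * a - 1)); last by ring.
by rewrite !gt0_powRD// powRr1 ?ltW.
Qed.

Lemma volterra_bounded h M : measurable_fun setT h -> (forall x, `|h x| <= M) ->
  exists K : R, forall v, `|G h (clamp T v)| <= K.
Proof.
move=> mh hM; eexists => v.
exact: (volterra_le a0 a1 phi_cont phi_ge0 phi_le T0 mh hM ltr01 (c0T v)).
Qed.

Lemma measurable_volterra h : bounded_continuous h ->
  measurable_fun setT (fun v => G h (clamp T v)).
Proof.
move=> hS; apply: continuous_measurable_fun.
exact: (continuous_volterra a0 phi_cont phi_ge0 phi_le T0 hS).
Qed.

(** G h is continuous and bounded by some [K], so [K * mker y] dominates the integrand for every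
    [u], including u = 0. *)
Lemma bounded_continuous_kernel_op h : bounded_continuous h ->
  bounded_continuous (kernel_op h).
Proof.
move=> hS; have [ch [M hM]] := hS.
have mh : measurable_fun setT h by exact: continuous_measurable_fun.
have cG := continuous_volterra a0 phi_cont phi_ge0 phi_le T0 hS.
have mG := measurable_volterra hS.
have [K GK] := volterra_bounded mh hM.
have mGu u : measurable_fun setT (fun y => G h (clamp T (clamp T u * y))).
  by apply: (measurableT_comp mG); exact: measurable_funM.
split; last first.
  exists (\int[mu]_(y in `]0, 1[) (K * mker y)) => u.
  apply: Rintegral_dominated => //.
  - by apply: integrableZl_fin => //; exact: integrable_mker.
  - by apply: measurable_funM; [exact: measurable_mker|apply: measurable_funTS; exact: mGu].
  - move=> y _; rewrite normrM ger0_norm ?mker_ge0// mulrC.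
    by rewrite ler_wpM2r// mker_ge0.
apply: (@continuous_Rintegral _ _ _ mu _ _ (fun y => K * mker y)) => //.
- by move=> u; apply: measurable_funM; [exact: measurable_mker|apply: measurable_funTS; exact: mGu].
- move=> y _ u; apply: cvgM; first exact: cvg_cst.
  apply: (@continuous_comp _ _ _ (fun u => clamp T u * y) (fun v => G h (clamp T v))).
    by apply: cvgM; [exact: continuous_clamp|exact: cvg_cst].
  exact: cG.
- by apply: integrableZl_fin => //; exact: integrable_mker.
- move=> u y _; rewrite normrM ger0_norm ?mker_ge0// mulrC.
  by rewrite ler_wpM2r// mker_ge0.
Qed.

Lemma kernel_op_le h K u : measurable_fun setT (fun v => G h (clamp T v)) ->
  (forall v, 0 <= v <= T -> `|G h v| <= K) ->
  `|kernel_op h u| <= (\int[mu]_(y in `]0, 1[) mker y) * K.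
Proof.
move=> mG GK; rewrite mulrC -RintegralZl//; last exact: integrable_mker.
apply: Rintegral_dominated => //.
- by apply: integrableZl_fin => //; exact: integrable_mker.
- apply: measurable_funM; first exact: measurable_mker.
  by apply: measurable_funTS; apply: (measurableT_comp mG); exact: measurable_funM.
- move=> y _; rewrite normrM ger0_norm ?mker_ge0// mulrC.
  by rewrite ler_wpM2r ?mker_ge0// GK.
Qed.

Lemma kernel_opB g h u : bounded_continuous g -> bounded_continuous h ->
  kernel_op (fun x => g x - h x) u = kernel_op g u - kernel_op h u.
Proof.
move=> gS hS; have [cg [M gM]] := gS; have [ch [M' hM']] := hS.
have mg : measurable_fun setT g by exact: continuous_measurable_fun.
have mh : measurable_fun setT h by exact: continuous_measurable_fun.
have mGc f : bounded_continuous f -> measurable_fun setT (fun y => G f (clamp T (clamp T u * y))).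
  move=> fS; have mG : measurable_fun setT (fun v => G f (clamp T v)).
    exact: measurable_volterra.
  by apply: (measurableT_comp mG); exact: measurable_funM.
have [K GK] := volterra_bounded mg gM; have [K' GK'] := volterra_bounded mh hM'.
rewrite /kernel_op -RintegralB//; last 2 first.
- by apply: integrable_mkerM; [exact: mGc|move=> x; exact: GK].
- by apply: integrable_mkerM; [exact: mGc|move=> x; exact: GK'].
apply: eq_Rintegral => y _; rewrite -mulrBr.
by congr (_ * _); apply: volterraB mg mh gM hM'.
Qed.

End kernel_operator.

(** * Positivity of the weighted quadratic form *)

Section fubini_for_the_kernel.
Context {R : realType} (a C T r : R) (phi : R -> R).
Notation mu := (@lebesgue_measure R).
Notation N := (ker a phi).
Notation G := (volterra a T phi).
Notation m := (mker a r phi).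
Notation A := (kernel_op a T r phi).
Implicit Types (g h : R -> R) (s u v y M : R).

(** N(s, v) vanishes for s <= v, so this and the next two lemmas replace the triangle v < s by the
    rectangles that [fubini_on] requires. *)
Lemma patch_extend (D E : set R) h : D `<=` E -> (forall x, E x -> ~ D x -> h x = 0) ->
  h \_ D = h \_ E.
Proof.
move=> DE h0; apply/funext => x; rewrite !patchE.
case: ifPn => [/set_mem Dx|/negP nDx]; first by rewrite mem_set//; exact: DE.
by case: ifPn => // /set_mem Ex; rewrite h0// => /mem_set.
Qed.

Lemma Rintegral_extend (D E : set (measurableTypeR R)) h :
  D `<=` E -> (forall x, E x -> ~ D x -> h x = 0) ->
  \int[mu]_(x in E) h x = \int[mu]_(x in D) h x.
Proof.
move=> DE h0; rewrite Rintegral_mkcond [RHS]Rintegral_mkcond.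
by rewrite (patch_extend DE h0).
Qed.

Lemma integrable_extend (D E : set (measurableTypeR R)) h :
  measurable D -> measurable E -> D `<=` E -> (forall x, E x -> ~ D x -> h x = 0) ->
  mu.-integrable D (EFin \o h) -> mu.-integrable E (EFin \o h).
Proof.
move=> mD mE DE h0 ih; apply/integrable_mkcond => //.
rewrite restrict_EFin -(patch_extend DE h0) -restrict_EFin.
by apply/(integrable_mkcond _ mD).1.
Qed.

Lemma integrable_powR_itv (e w : R) : 0 < e ->
  mu.-integrable `]0, w[ (EFin \o (fun z => z `^ (e - 1))).
Proof.
move=> e0; have := integrable_shift_powR 0 w e0.
by apply: eq_integrable => // s _; rewrite /= subr0.
Qed.

Context (a0 : 0 < a) (a1 : a < 1) (phi_cont : continuous phi)
  (phi_ge0 : forall y, 0 <= phi y) (phi_le : forall y, phi y <= C) (T0 : 0 < T)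
  (r1 : r < 1).

Lemma itv_extend0l v (x : R) : 0 <= v -> `]0, T[%classic x -> ~ `]v, T[%classic x -> x <= v.
Proof.
by move=> v0 /=; rewrite !in_itv/= => /andP[x0 xT] /negP; rewrite xT andbT -leNgt.
Qed.

Lemma subset_itv0l v : 0 <= v -> `]v, T[ `<=` (`]0, T[ : set R).
Proof. by move=> v0; apply: subset_itvr; rewrite bnd_simp. Qed.

Lemma volterra_extend h v : 0 <= v ->
  \int[mu]_(s in `]0, T[) (N s v * h s) = G h v.
Proof.
move=> v0; apply: Rintegral_extend; first exact: subset_itv0l.
by move=> x x0T /(itv_extend0l v0 x0T) xv; rewrite ker_eq0// mul0r.
Qed.

Lemma integrable_volterra_extend h v M : measurable_fun setT h ->
  (forall x, `|h x| <= M) -> 0 <= v ->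
  mu.-integrable `]0, T[ (EFin \o (fun s => N s v * h s)).
Proof.
move=> mh hM v0; apply: (@integrable_extend `]v, T[) => //; first exact: subset_itv0l.
  by move=> x x0T /(itv_extend0l v0 x0T) xv; rewrite ker_eq0// mul0r.
exact: (integrable_volterra T a0 phi_cont phi_ge0 phi_le v mh hM).
Qed.

Lemma measurable_weight_ker (D : set (measurableTypeR R)) u :
  measurable_fun D (fun v : measurableTypeR R => v `^ (- r) * N u v).
Proof.
by apply: measurable_funM; [exact: measurable_powR_itv|exact: (measurable_kerr _ phi_cont)].
Qed.

Lemma integrable_weight_ker u : 0 < u ->
  mu.-integrable `]0, u[ (EFin \o (fun v => v `^ (- r) * N u v)).
Proof.
move=> u0; apply: integrable_itv01 => //; first exact: measurable_weight_ker.
rewrite subr0; apply: (@eq_integrable _ _ _ mu _ _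
  (EFin \o (fun z => u `^ (- r) * u `^ (2 * a - 1) * m z))) => //.
  move=> z; rewrite inE/= in_itv/= => /andP[z0 z1]; rewrite add0r /mker.
  have -> : N u (u * z) = u `^ (2 * a - 1) * N 1 z by rewrite -kerM// mulr1.
  by rewrite powRM ?(ltW u0) ?(ltW z0)//; congr EFin; ring.
apply: integrableZl_fin => //; exact: (integrable_mker a0 phi_cont phi_ge0 phi_le r1).
Qed.

Lemma integrable_weight_ker_extend u : 0 < u -> u <= T ->
  mu.-integrable `]0, T[ (EFin \o (fun v => v `^ (- r) * N u v)).
Proof.
move=> u0 uT; apply: (@integrable_extend `]0, u[) => //.
- by apply: subset_itvl; rewrite bnd_simp.
- move=> v /=; rewrite !in_itv/= => /andP[v0 vT] /negP; rewrite v0/= -leNgt => uv.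
  by rewrite ker_eq0// mulr0.
- exact: integrable_weight_ker.
Qed.

Lemma kernel_op_weighted h u : bounded_continuous h -> 0 < u <= T ->
  u `^ (2 * a - r) * A h u =
  \int[mu]_(v in `]0, u[) (v `^ (- r) * N u v * G h v).
Proof.
move=> hS /andP[u0 uT]; have [ch [M hM]] := hS.
have mh : measurable_fun setT h by exact: continuous_measurable_fun.
have [K GK] := volterra_bounded a0 a1 phi_cont phi_ge0 phi_le T0 mh hM.
have mG := measurable_volterra a0 phi_cont phi_ge0 phi_le T0 hS.
rewrite /kernel_op clamp_id ?(ltW u0)//.
apply: (etrans (esym (mker_subst a0 phi_cont phi_ge0 phi_le r1 mG GK u0))).
apply: eq_Rintegral => v; rewrite inE/= in_itv/= => /andP[v0 vu].
by rewrite clamp_id// (ltW v0) (le_trans (ltW vu)).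
Qed.

(** Take h(u) v ^ (- r) N(u, v) (G h)(v) on the square: integrating in v gives the weighted h A h,
    integrating in u gives v ^ (- r) (G h)(v) ^ 2. The integrability half is what later allows the
    energy to be split off from a sum. *)
Lemma fubini_energy h : bounded_continuous h ->
  mu.-integrable `]0, T[ (EFin \o (fun u => u `^ (2 * a - r) * (h u * A h u))) /\
  0 <= \int[mu]_(u in `]0, T[) (u `^ (2 * a - r) * (h u * A h u)).
Proof.
move=> hS; have [ch [M hM]] := hS.
have mh : measurable_fun setT h by exact: continuous_measurable_fun.
have mnh : measurable_fun setT (fun x => `|h x|) by exact: measurableT_comp.
have hnM x : `| `|h x| | <= M by rewrite normr_id.
have [K GK] := volterra_bounded a0 a1 phi_cont phi_ge0 phi_le T0 mh hM.
have [K' GK'] := volterra_bounded a0 a1 phi_cont phi_ge0 phi_le T0 mnh hnM.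
have mG := measurable_volterra a0 phi_cont phi_ge0 phi_le T0 hS.
pose f (z : measurableTypeR R * measurableTypeR R) : R :=
  h z.1 * (z.2 `^ (- r) * N z.1 z.2 * G h (clamp T z.2)).
have m1 : measurable_fun setT (fun z : measurableTypeR R * measurableTypeR R => z.1 : R).
  exact: measurable_fst.
have m2 : measurable_fun setT (fun z : measurableTypeR R * measurableTypeR R => z.2 : R).
  exact: measurable_snd.
have mf : measurable_fun setT f.
  apply: measurable_funM; first exact: (measurableT_comp mh m1).
  apply: measurable_funM; last exact: (measurableT_comp mG m2).
  apply: measurable_funM; last exact: measurable_ker.
  exact: (measurableT_comp (measurable_powR (- r)) m2).
have inner u : 0 < u < T ->
    \int[mu]_(v in `]0, T[) f (u, v) = u `^ (2 * a - r) * (h u * A h u).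
  move=> /andP[u0 uT]; rewrite mulrCA kernel_op_weighted ?u0 ?ltW//.
  rewrite (@Rintegral_extend `]0, u[); last 2 first.
  - by apply: subset_itvl; rewrite bnd_simp ltW.
  - move=> v /=; rewrite !in_itv/= => /andP[v0 vT] /negP; rewrite v0/= -leNgt => uv.
    by rewrite /f/= ker_eq0// mulr0 mul0r mulr0.
  have ii : mu.-integrable `]0, u[ (EFin \o (fun v => v `^ (- r) * N u v * G h v)).
    apply: (@integrable_dominated _ _ _ mu _ (fun v => K * (v `^ (- r) * N u v))) => //.
    - by apply: integrableZl_fin => //; exact: integrable_weight_ker.
    - apply: (@eq_measurable_fun _ _ _ _ _ (fun v => v `^ (- r) * N u v * G h (clamp T v))).
        move=> v; rewrite inE/= in_itv/= => /andP[v0 vu].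
        by rewrite clamp_id// (ltW v0) (ltW (lt_trans vu uT)).
      apply: measurable_funM; first exact: measurable_weight_ker.
      exact: measurable_funTS.
    - move=> v /=; rewrite in_itv/= => /andP[v0 vu].
      have w0 : 0 <= v `^ (- r) * N u v by rewrite mulr_ge0 ?powR_ge0 ?ker_ge0.
      rewrite mulrC normrM [X in _ * X]ger0_norm// ler_wpM2r//.
      by have := GK v; rewrite clamp_id// (ltW v0) (ltW (lt_trans vu uT)).
  rewrite -[RHS]RintegralZl; [|by []|exact: ii].
  apply: eq_Rintegral => v; rewrite inE/= in_itv/= => /andP[v0 vu].
  by rewrite /f/= clamp_id// (ltW v0) (ltW (lt_trans vu uT)).
have inner2 v : 0 < v < T ->
    \int[mu]_(u in `]0, T[) f (u, v) = v `^ (- r) * G h v ^+ 2.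
  move=> /andP[v0 vT].
  rewrite (@eq_Rintegral _ _ _ mu _ (fun u => v `^ (- r) * G h v * (N u v * h u))); last first.
    by move=> u _; rewrite /f/= clamp_id ?(ltW v0) ?ltW//; ring.
  rewrite RintegralZl//; last exact: integrable_volterra_extend mh hM (ltW v0).
  by rewrite volterra_extend ?ltW// expr2 mulrA.
(* [K] bounds G h and [K'] bounds G |h|. The exponent - r is written 1 - r - 1 to match
   [integrable_powR_itv] with e = 1 - r > 0. *)
have [||||iF FE] := @fubini_on _ _ _ _ R mu mu `]0, T[%classic `]0, T[%classic f
    (fun v => K * K' * v `^ (1 - r - 1)) ltac:(by []) ltac:(by []) mf.
- move=> u; rewrite /= in_itv/= => /andP[u0 uT].
  apply: (@integrable_dominated _ _ _ mu _ (fun v => M * K * (v `^ (- r) * N u v))) => //.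
  + by apply: integrableZl_fin => //; apply: integrable_weight_ker_extend => //; exact: ltW.
  + by apply: measurable_funTS; exact: (measurable_fun_pair2 u mf).
  + move=> v _; rewrite /f/= normrM normrM.
    have w0 : 0 <= v `^ (- r) * N u v by rewrite mulr_ge0 ?powR_ge0 ?ker_ge0.
    rewrite (ger0_norm w0) [leRHS](_ : _ = M * (v `^ (- r) * N u v * K)); last by ring.
    by apply: ler_pM => //; [exact: mulr_ge0|exact: ler_wpM2l].
- move=> v; rewrite /= in_itv/= => /andP[v0 vT].
  apply: (@eq_integrable _ _ _ mu _ _
     (EFin \o (fun u => v `^ (- r) * G h v * (N u v * h u)))) => //.
    by move=> u _; rewrite /f/= clamp_id ?(ltW v0) ?ltW//; congr EFin; ring.
  apply: integrableZl_fin => //; exact: integrable_volterra_extend mh hM (ltW v0).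
- by apply: integrableZl_fin => //; apply: integrable_powR_itv; rewrite subr_gt0.
- move=> v; rewrite /= in_itv/= => /andP[v0 vT].
  rewrite (@eq_Rintegral _ _ _ mu _ (fun u => v `^ (- r) * `|G h v| * (N u v * `|h u|))); last first.
    move=> u _; rewrite /f/= clamp_id ?(ltW v0) ?ltW// normrM normrM.
    have w0 : 0 <= v `^ (- r) * N u v by rewrite mulr_ge0 ?powR_ge0 ?ker_ge0.
    by rewrite (ger0_norm w0); ring.
  rewrite RintegralZl; [|by []|exact: integrable_volterra_extend mnh hnM (ltW v0)].
  rewrite volterra_extend ?(ltW v0)//.
  rewrite (_ : 1 - r - 1 = - r); last by ring.
  rewrite [leRHS](_ : _ = v `^ (- r) * K * K'); last by ring.
  have cv : clamp T v = v by rewrite clamp_id// (ltW v0) ltW.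
  have := GK v; have := GK' v; rewrite cv => h1 h2.
  apply: ler_pM.
  + by rewrite mulr_ge0 ?powR_ge0.
  + by apply: Rintegral_ge0 => s _; rewrite mulr_ge0 ?ker_ge0.
  + by rewrite ler_wpM2l ?powR_ge0.
  + exact: le_trans (ler_norm _) h1.
have eqF : {in `]0, T[%classic, (fun u : measurableTypeR R => \int[mu]_(v in `]0, T[) f (u, v)) =1
    (fun u : measurableTypeR R => u `^ (2 * a - r) * (h u * A h u))}.
  by move=> u; rewrite inE/= in_itv/=; exact: inner.
split.
  apply: eq_integrable iF; first by [].
  by move=> u uT; congr EFin; exact: eqF.
have -> : \int[mu]_(u in `]0, T[) (u `^ (2 * a - r) * (h u * A h u)) =
    \int[mu]_(u in `]0, T[) \int[mu]_(v in `]0, T[) f (u, v).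
  by apply: eq_Rintegral => u uT; apply/esym; exact: eqF.
rewrite FE; apply: Rintegral_ge0 => v /=.
rewrite in_itv/= => /inner2 ->.
by apply: mulr_ge0; [exact: powR_ge0|exact: sqr_ge0].
Qed.

End fubini_for_the_kernel.

(** * The integral term of the equation as the operator A *)

Section fubini_for_the_equation.
Context {R : realType} (a C T r : R) (phi : R -> R).
Notation mu := (@lebesgue_measure R).
Notation N := (ker a phi).
Notation G := (volterra a T phi).
Notation A := (kernel_op a T r phi).
Implicit Types (g h : R -> R) (s u v y M : R).

Lemma integral_setD1_measurable (D : set R) (x : R) (f : R -> \bar R) :
  measurable D -> measurable_fun (D `\ x) f ->
  measurable_fun D f /\
  (\int[mu]_(y in D `\ x) f y = \int[mu]_(y in D) f y)%E.
Proof.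
move=> mD mf; have mDx : measurable (D `\ x) by exact: measurableD.
split; last exact: integral_setD1.
have [Dx|nDx] := pselect (D x); last by move: mf; rewrite not_setD1.
rewrite -(setD1K Dx); apply/measurable_funU => //.
by split => //; exact: measurable_fun_set1.
Qed.

(** The product formula for kappa fails at s = u, where kappa is 0 by convention. Measurability and
    the value of the integral are therefore established off that point and carried over, a point
    being null. *)
Lemma integral_punctured (D : set (measurableTypeR R)) (x : R) (f g : R -> R) (I : R) :
  measurable D -> mu.-integrable (D `\ x) (EFin \o g) ->
  (forall y, (D `\ x) y -> f y = g y) -> \int[mu]_(y in D `\ x) g y = I ->
  measurable_fun D (EFin \o f) /\ (\int[mu]_(y in D) (f y)%:E = I%:E)%E.
Proof.
move=> mD ig fg gI; have mDx : measurable (D `\ x) by exact: measurableD.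
have ifx : mu.-integrable (D `\ x) (EFin \o f).
  apply: (eq_integrable mDx _ _ _ ig) => y /set_mem Dy.
  by rewrite /= fg.
have [mf <-] := integral_setD1_measurable mD (measurable_int _ ifx).
split=> //; rewrite -gI /Rintegral fineK; last exact: integrable_fin_num.
by apply: eq_integral => y /set_mem Dy; rewrite /= fg.
Qed.

Context (a0 : 0 < a) (a1 : a < 1) (phi_cont : continuous phi)
  (phi_ge0 : forall y, 0 <= phi y) (phi_le : forall y, phi y <= C) (T0 : 0 < T)
  (r1 : r < 1).

(* The smaller of s and u carries the singularity of the product in v. *)
Lemma ker_prod_le s u v : 0 < s -> s <= T -> 0 < u -> u <= T -> s != u -> 0 <= v ->
  N s v * N u v <= C * T `^ a * `|s - u| `^ (a - 1) * (N s v + N u v).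
Proof.
move=> s0 sT u0 uT su v0.
have C0 : 0 <= C * T `^ a.
  by rewrite mulr_ge0 ?powR_ge0//; exact: le_trans (phi_ge0 0) (phi_le 0).
have a10 : a - 1 <= 0 by rewrite subr_le0 ltW.
have half (x y : R) : 0 < x -> x < y -> y <= T ->
    N x v * N y v <= C * T `^ a * (y - x) `^ (a - 1) * (N x v + N y v).
  move=> x0 xy yT; have [vx|xv] := ltP v x; last first.
    rewrite (ker_eq0 a phi xv) mul0r; apply: mulr_ge0; first by rewrite mulr_ge0 ?powR_ge0.
    by rewrite addr_ge0 ?ker_ge0.
  have vy := lt_trans vx xy.
  apply: (@le_trans _ _ (N x v * (C * T `^ a * (y - x) `^ (a - 1)))); last first.
    by rewrite mulrC ler_wpM2l ?(mulr_ge0 C0) ?powR_ge0// lerDl ker_ge0.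
  rewrite ler_wpM2l ?ker_ge0//.
  apply: (le_trans (ker_le a0 phi_ge0 phi_le vy yT)).
  rewrite ler_wpM2l//; apply: le0_ger_powR => //; first by rewrite subr_gt0.
  by rewrite lerD2l lerN2 ltW.
move: su; rewrite neq_lt => /orP[su|us].
  by rewrite distrC ger0_norm ?subr_ge0 ?(ltW su)// half.
by rewrite ger0_norm ?subr_ge0 ?(ltW us)// [N s v * _]mulrC [N s v + _]addrC half.
Qed.

(** At s = u the inner integrand contains N(u, v) ^ 2, which need not be integrable, hence the
    puncture. Elsewhere [ker_prod_le] makes the sections in v integrable, and the bound of G |h|
    dominates after integration in s. *)
Lemma kernel_op_fubini h u : bounded_continuous h -> 0 < u <= T ->
  mu.-integrable (`]0, T[ `\ u)
    (EFin \o (fun s => h s * \int[mu]_(v in `]0, u[) (v `^ (- r) * N s v * N u v))) /\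
  \int[mu]_(s in `]0, T[ `\ u)
    (h s * \int[mu]_(v in `]0, u[) (v `^ (- r) * N s v * N u v)) =
  u `^ (2 * a - r) * A h u.
Proof.
move=> hS u0T; have /andP[u0 uT] := u0T; have [ch [M hM]] := hS.
have mh : measurable_fun setT h by exact: continuous_measurable_fun.
have mnh : measurable_fun setT (fun x => `|h x|) by exact: measurableT_comp.
have hnM x : `| `|h x| | <= M by rewrite normr_id.
have [K' GK'] := volterra_bounded a0 a1 phi_cont phi_ge0 phi_le T0 mnh hnM.
have mD : measurable (`]0, T[ `\ u : set (measurableTypeR R)).
  exact: measurableD.
have mDE (f : R -> R) : measurable_fun (`]0, T[ `\ u : set (measurableTypeR R)) f ->
    \int[mu]_(s in `]0, T[ `\ u) f s = \int[mu]_(s in `]0, T[) f s.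
  by move=> mf; rewrite /Rintegral integral_setD1//; exact/measurable_EFinP.
pose f (z : measurableTypeR R * measurableTypeR R) : R :=
  h z.1 * (z.2 `^ (- r) * N z.1 z.2 * N u z.2).
have m1 : measurable_fun setT (fun z : measurableTypeR R * measurableTypeR R => z.1 : R).
  exact: measurable_fst.
have m2 : measurable_fun setT (fun z : measurableTypeR R * measurableTypeR R => z.2 : R).
  exact: measurable_snd.
have mf : measurable_fun setT f.
  apply: measurable_funM; first exact: (measurableT_comp mh m1).
  apply: measurable_funM; last by apply: measurable_ker => //; exact: measurable_cst.
  apply: measurable_funM; last exact: measurable_ker.
  exact: (measurableT_comp (measurable_powR (- r)) m2).
have subD : `]0, T[ `\ u `<=` (`]0, T[ : set R) by move=> x [].
have iDh v g L : measurable_fun setT g -> (forall x, `|g x| <= L) -> 0 < v ->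
    mu.-integrable (`]0, T[ `\ u) (EFin \o (fun s => N s v * g s)).
  move=> mg gL v0; apply: (@integrableS _ _ _ mu `]0, T[) => //.
  exact: (integrable_volterra_extend T a0 phi_cont phi_ge0 phi_le mg gL (ltW v0)).
have volt v g L : measurable_fun setT g -> (forall x, `|g x| <= L) -> 0 < v ->
    \int[mu]_(s in `]0, T[ `\ u) (N s v * g s) = G g v.
  move=> mg gL v0; rewrite mDE; last exact: measurable_volterra_integrand.
  by rewrite volterra_extend// ltW.
have innerE s : 0 < s < T -> s != u -> mu.-integrable `]0, u[
    (EFin \o (fun v => v `^ (- r) * N s v * N u v)).
  move=> /andP[s0 sT] su.
  apply: (@integrable_dominated _ _ _ mu _ (fun v => C * T `^ a * `|s - u| `^ (a - 1) *
     (v `^ (- r) * N s v + v `^ (- r) * N u v))) => //.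
  - apply: integrableZl_fin => //; apply: integrableD_fin => //.
      apply: (@integrableS _ _ _ mu `]0, T[) => //.
        by apply: subset_itvl; rewrite bnd_simp.
      exact: (integrable_weight_ker_extend a0 phi_cont phi_ge0 phi_le r1 s0 (ltW sT)).
    exact: (integrable_weight_ker a0 phi_cont phi_ge0 phi_le r1 u0).
  - apply: measurable_funM; last exact: (measurable_kerr _ phi_cont).
    by apply: measurable_weight_ker.
  - move=> v /=; rewrite in_itv/= => /andP[v0 vu].
    rewrite ger0_norm ?mulr_ge0 ?powR_ge0 ?ker_ge0// -mulrA -mulrDr.
    rewrite [leRHS](_ : _ = v `^ (- r) *
      (C * T `^ a * `|s - u| `^ (a - 1) * (N s v + N u v))); last by ring.
    by rewrite ler_wpM2l ?powR_ge0// ker_prod_le// ltW.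
have [||||iF FE] := @fubini_on _ _ _ _ R mu mu (`]0, T[%classic `\ u) `]0, u[%classic f
    (fun v => K' * (v `^ (- r) * N u v)) mD ltac:(by []) mf.
- move=> s [/=]; rewrite in_itv/= => s0T /eqP su.
  apply: (@integrableZl_fin _ _ _ mu `]0, u[%classic (h s)
    (fun v => v `^ (- r) * N s v * N u v)); [by []|exact: innerE].
- move=> v /=; rewrite in_itv/= => /andP[v0 vu].
  apply: (@eq_integrable _ _ _ mu _ mD
     (EFin \o (fun s => v `^ (- r) * N u v * (N s v * h s)))).
    by move=> s _; rewrite /f/=; congr EFin; ring.
  by apply: integrableZl_fin => //; exact: iDh mh hM v0.
- apply: integrableZl_fin; first by [].
  exact: (integrable_weight_ker a0 phi_cont phi_ge0 phi_le r1 u0).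
- move=> v /=; rewrite in_itv/= => /andP[v0 vu].
  have w0 : 0 <= v `^ (- r) * N u v by rewrite mulr_ge0 ?powR_ge0 ?ker_ge0.
  rewrite (@eq_Rintegral _ _ _ mu _ (fun s => v `^ (- r) * N u v * (N s v * `|h s|))); last first.
    move=> s _; have w1 : 0 <= v `^ (- r) * N s v * N u v.
      by rewrite !mulr_ge0 ?powR_ge0 ?ker_ge0.
    by rewrite /f/= normrM (ger0_norm w1); ring.
  rewrite RintegralZl; [|exact: mD|exact: iDh mnh hnM v0].
  rewrite (volt _ _ _ mnh hnM v0) mulrC ler_wpM2r//.
  have := GK' v; rewrite clamp_id; last by rewrite (ltW v0) (le_trans (ltW vu)).
  by apply: le_trans; exact: ler_norm.
have eqF s : s \in `]0, T[%classic `\ u -> \int[mu]_(v in `]0, u[) f (s, v) =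
   h s * \int[mu]_(v in `]0, u[) (v `^ (- r) * N s v * N u v).
  rewrite inE => -[/=]; rewrite in_itv/= => s0T /eqP su.
  apply: (@RintegralZl _ _ _ mu `]0, u[%classic
    (fun v => v `^ (- r) * N s v * N u v) (h s)); [by []|exact: innerE].
split.
  by apply: eq_integrable iF; [exact: mD|move=> s sD; congr EFin; exact: eqF].
transitivity (\int[mu]_(s in `]0, T[ `\ u) \int[mu]_(v in `]0, u[) f (s, v)).
  by apply: eq_Rintegral => s sD; apply/esym; exact: eqF.
rewrite FE (kernel_op_weighted a0 a1 phi_cont phi_ge0 phi_le T0 r1 hS u0T).
apply: eq_Rintegral => v; rewrite inE/= in_itv/= => /andP[v0 vu].
rewrite (@eq_Rintegral _ _ _ mu _ (fun s => v `^ (- r) * N u v * (N s v * h s))); last first.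
  by move=> s _; rewrite /f/=; ring.
rewrite RintegralZl; [|exact: mD|exact: iDh mh hM v0].
by rewrite (volt _ _ _ mh hM v0).
Qed.

End fubini_for_the_equation.

(** * A priori bound, existence and uniqueness for h + l A h = f *)

Section well_posedness.
Context {R : realType} (a C T r : R) (phi : R -> R).
Notation mu := (@lebesgue_measure R).
Notation N := (ker a phi).
Notation G := (volterra a T phi).
Notation A := (kernel_op a T r phi).
Implicit Types (g h f : R -> R) (s u v y M c l : R).

Context (a0 : 0 < a) (a1 : a < 1) (phi_cont : continuous phi)
  (phi_ge0 : forall y, 0 <= phi y) (phi_le : forall y, phi y <= C) (T0 : 0 < T)
  (r1 : r < 1) (r2a : 0 <= r - 2 * a).

Let W := \int[mu]_(u in `]0, T[) u `^ (2 * a - r).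

Let iW : mu.-integrable `]0, T[ (EFin \o (fun u => u `^ (2 * a - r))).
Proof.
have -> : 2 * a - r = (1 + 2 * a - r) - 1 by ring.
by apply: integrable_powR_itv; have := a0; have := r1; lra.
Qed.

(* Integrate h + l A h = f against u ^ (2 a - r) h and drop the term with A. *)
Lemma L1_le h c l : bounded_continuous h -> 0 <= l -> 0 < c ->
  (forall u, `|h u + l * A h u| <= c) ->
  \int[mu]_(u in `]0, T[) `|h u| <= c * (T + T `^ (r - 2 * a) * W) / 2.
Proof.
move=> hS l0 c0 hc; have [ch [M hM]] := hS.
have mh : measurable_fun setT h by exact: continuous_measurable_fun.
have mnh : measurable_fun setT (fun x => `|h x|) by exact: measurableT_comp.
have hnM x : `| `|h x| | <= M by rewrite normr_id.
have [iE E0] := fubini_energy a0 a1 phi_cont phi_ge0 phi_le T0 r1 hS.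
set E := \int[mu]_(u in _) _ in E0.
pose B := T `^ (r - 2 * a).
have B0 : 0 <= B by exact: powR_ge0.
(* With x = h(u) and z = (A h)(u), squaring the hypothesis gives x ^ 2 <= c ^ 2 - 2 l x z. The right
   side is thus nonnegative and may be multiplied by B u ^ (2 a - r) >= 1. Conclude with 2 c |x| <=
   c ^ 2 + x ^ 2. The energy enters with the factor - B l / c <= 0. *)
have pointwise u : `]0, T[%classic u ->
    `|h u| <= c / 2 + (B * c / 2) * u `^ (2 * a - r) +
      - (B * l / c) * (u `^ (2 * a - r) * (h u * A h u)).
  rewrite /= in_itv/= => /andP[u0 uT].
  have Bw : 1 <= B * u `^ (2 * a - r).
    have BT : B * T `^ (2 * a - r) = 1.
      rewrite /B -gt0_powRD// (_ : r - 2 * a + (2 * a - r) = 0) ?powRr0//; by ring.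
    rewrite -[leLHS]BT ler_wpM2l//; apply: le0_ger_powR; rewrite ?(ltW uT)//.
    by rewrite -oppr_ge0 opprB.
  have w0 : 0 <= B * u `^ (2 * a - r) by apply: le_trans Bw.
  have hcu := hc u.
  rewrite [leRHS](_ : _ = (c ^+ 2 + (B * u `^ (2 * a - r)) *
     (c ^+ 2 - 2 * l * (h u * A h u))) / (2 * c)); last by field; rewrite gt_eqF.
  rewrite ler_pdivlMr ?mulr_gt0//.
  set w := B * _ in Bw w0 *; set x := h u in hcu *; set z := A h u in hcu *.
  have key : x ^+ 2 <= c ^+ 2 - 2 * l * (x * z).
    have : (x + l * z) ^+ 2 <= c ^+ 2.
      by rewrite -(real_normK (num_real _)) lerXn2r ?nnegrE// ltW.
    have := sqr_ge0 (l * z); rewrite !sqrrD !expr2; lra.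
  have D0 := le_trans (sqr_ge0 x) key.
  have D1 := ler_wpM2r D0 Bw; rewrite mul1r in D1.
  have := sqr_ge0 (c - `|x|); rewrite sqrrB (real_normK (num_real x)).
  move: D1 key; lra.
have ic : mu.-integrable `]0, T[ (EFin \o (fun=> c / 2)) by exact: integrable_cst_itv.
have iw : mu.-integrable `]0, T[ (EFin \o (fun u => B * c / 2 * u `^ (2 * a - r))).
  by apply: integrableZl_fin => //.
have ie : mu.-integrable `]0, T[
    (EFin \o (fun u => - (B * l / c) * (u `^ (2 * a - r) * (h u * A h u)))).
  by apply: integrableZl_fin => //.
apply: (@le_trans _ _ (\int[mu]_(u in `]0, T[) (c / 2 + B * c / 2 * u `^ (2 * a - r) +
    - (B * l / c) * (u `^ (2 * a - r) * (h u * A h u))))).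
  apply: le_Rintegral; [by []| | |exact: pointwise].
    exact: integrable_bounded_itv mnh hnM.
  by apply: integrableD_fin; [by []| |exact: ie]; exact: integrableD_fin.
rewrite RintegralD; [|by []|exact: integrableD_fin|exact: ie].
rewrite RintegralD; [|by []|exact: ic|exact: iw].
rewrite [X in _ + X + _]RintegralZl; [|by []|exact: iW].
rewrite [X in _ + X <= _]RintegralZl; [|by []|exact: iE].
have -> : \int[mu]_(_ in `]0, T[) (c / 2) = c / 2 * T.
  by rewrite Rintegral_cst//= lebesgue_measure_itv/= lte_fin T0 -EFinB subr0.
rewrite -/W -/E.
have : 0 <= B * l / c * E by rewrite mulr_ge0// divr_ge0 ?mulr_ge0// ltW.
rewrite -/B; lra.
Qed.

Let M1 := \int[mu]_(y in `]0, 1[) mker a r phi y.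
(** The coefficient of [M] in [volterra_le] without its factor del ^ (a / 2). *)
Let kap := C * T `^ a * (T `^ (a / 2) * \int[mu]_(z in `]0, 1[) z `^ (a / 2 - 1)).

Let C0 : 0 <= C. Proof. exact: le_trans (phi_ge0 0) (phi_le 0). Qed.

Let M1_ge0 : 0 <= M1.
Proof. by apply: Rintegral_ge0 => y _; exact: mker_ge0. Qed.

Let kap_ge0 : 0 <= kap.
Proof.
rewrite !mulr_ge0 ?powR_ge0//.
by apply: Rintegral_ge0 => y _; exact: powR_ge0.
Qed.

Lemma kernel_op_le_split h M del u : bounded_continuous h -> (forall x, `|h x| <= M) ->
  0 < del ->
  `|A h u| <= M1 * (del `^ (a / 2) * kap * M +
     C * T `^ a * del `^ (a - 1) * \int[mu]_(s in `]0, T[) `|h s|).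
Proof.
move=> hS hM d0; have [ch _] := hS.
have mh : measurable_fun setT h by exact: continuous_measurable_fun.
apply: (kernel_op_le a0 phi_cont phi_ge0 phi_le T0 r1).
  exact: (measurable_volterra a0 phi_cont phi_ge0 phi_le T0 hS).
move=> v vT; have := volterra_le a0 a1 phi_cont phi_ge0 phi_le T0 mh hM d0 vT.
by move=> /le_trans; apply; rewrite lerD2r /kap le_eqVlt; apply/orP; left; apply/eqP; ring.
Qed.

Lemma kernel_op_bounded : exists2 K : R, 0 < K &
  forall h c, bounded_continuous h -> (forall x, `|h x| <= c) ->
  forall u, `|A h u| <= K * c.
Proof.
have CT0 : 0 <= C * T `^ a * T by rewrite !mulr_ge0 ?powR_ge0 ?(ltW T0).
(* The split at [del] = 1 combined with |h|_1 <= c T; the final 1 makes the constant positive, as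
   [continuity_method] asks. *)
exists (M1 * (kap + C * T `^ a * T) + 1).
  by rewrite ltr_wpDl// mulr_ge0// addr_ge0.
move=> h c hS hc u; have [ch _] := hS.
have c0 : 0 <= c by exact: le_trans (normr_ge0 _) (hc 0).
have mh : measurable_fun setT h by exact: continuous_measurable_fun.
have mnh : measurable_fun setT (fun x => `|h x|) by exact: measurableT_comp.
have hnc x : `| `|h x| | <= c by rewrite normr_id.
have IcT : \int[mu]_(s in `]0, T[) `|h s| <= c * T.
  rewrite (_ : c * T = \int[mu]_(_ in `]0, T[) c); last first.
    by rewrite Rintegral_cst//= lebesgue_measure_itv/= lte_fin T0 -EFinB subr0.
  apply: le_Rintegral; [by []| | |by move=> x _; exact: hc].
    exact: integrable_bounded_itv mnh hnc.
  exact: integrable_cst_itv.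
have := kernel_op_le_split u hS hc ltr01; rewrite !powR1 mul1r mulr1 => /le_trans; apply.
rewrite [leRHS](_ : _ = M1 * (kap * c + C * T `^ a * (c * T)) + c); last by ring.
by rewrite ler_wpDr// ler_wpM2l// lerD2l ler_wpM2l// mulr_ge0// powR_ge0.
Qed.

Lemma apriori_bound (L : R) : 0 <= L -> exists2 K : R, 0 < K &
  forall l, 0 <= l <= L -> forall h c, bounded_continuous h -> 0 < c ->
  (forall u, `|h u + l * A h u| <= c) -> forall u, `|h u| <= K * c.
Proof.
move=> L0.
(* Chosen so that L M1 kap / D <= 1/2, the 1 keeping [D] positive. Then [del] is defined by del ^ (a
   / 2) = 1 / D, so the sup term of l A h is at most M / 2. *)
pose D : R := 2 * L * M1 * kap + 1.
have LM0 : 0 <= L * M1 * kap := mulr_ge0 (mulr_ge0 L0 M1_ge0) kap_ge0.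
have D0 : 0 < D by rewrite /D; move: LM0; lra.
pose del := D^-1 `^ (2 / a).
have d0 : 0 < del by rewrite powR_gt0 ?invr_gt0.
have del2 : del `^ (a / 2) = D^-1.
  rewrite /del -powRrM (_ : 2 / a * (a / 2) = 1) ?powRr1 ?invr_ge0 ?ltW//.
  by field; rewrite gt_eqF.
pose B := T `^ (r - 2 * a).
have W0 : 0 <= W by apply: Rintegral_ge0 => u _; exact: powR_ge0.
have TBW0 : 0 <= (T + B * W) / 2.
  by rewrite divr_ge0// addr_ge0 ?(ltW T0)// mulr_ge0 ?powR_ge0.
pose P := C * T `^ a * del `^ (a - 1).
have P0 : 0 <= P by rewrite !mulr_ge0 ?powR_ge0.
(* The 1 comes from f and the rest from the L^1 term bounded by [L1_le]; absorbing M / 2 then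
   doubles the constant. *)
pose K1 := 1 + L * M1 * P * ((T + B * W) / 2).
have LMP0 : 0 <= L * M1 * P := mulr_ge0 (mulr_ge0 L0 M1_ge0) P0.
have K10 : 0 < K1 by rewrite /K1; have := mulr_ge0 LMP0 TBW0; lra.
exists (2 * K1); first by rewrite mulr_gt0.
move=> l /andP[l0 lL] h c hS c0 hc; have [ch [M0 hM0]] := hS.
suff : forall u, `|h u| <= 2 * (K1 * c) by move=> H u; rewrite -mulrA.
apply: (norm_le_absorb hM0) => M hM u.
have M_ge0 : 0 <= M by exact: le_trans (normr_ge0 _) (hM 0).
have I1 := L1_le hS l0 c0 hc; rewrite -/B in I1.
have I0 : 0 <= \int[mu]_(s in `]0, T[) `|h s| by apply: Rintegral_ge0.
have := kernel_op_le_split u hS hM d0; rewrite del2 -/P.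
set I := \int[mu]_(s in _) _ in I1 I0 * => Ah.
have h1 : `|h u| <= c + L * `|A h u|.
  rewrite -[h u](addrK (l * A h u)) (le_trans (ler_normB _ _))// lerD//.
  by rewrite normrM (ger0_norm l0) ler_wpM2r.
have h2 : L * `|A h u| <= L * (M1 * (D^-1 * kap * M + P * I)) by rewrite ler_wpM2l.
have h3 : L * M1 * P * I <= L * M1 * P * (c * (T + B * W) / 2).
  by rewrite ler_wpM2l.
have h4 : L * M1 * kap * D^-1 * M <= M / 2.
  rewrite mulrC ler_wpM2l// ler_pdivrMr// /D.
  move: LM0.
  lra.
move: h1 h2 h3 h4; rewrite /K1.
rewrite (_ : L * (M1 * (D^-1 * kap * M + P * I)) =
  L * M1 * kap * D^-1 * M + L * M1 * P * I); last by ring.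
rewrite (_ : (1 + L * M1 * P * ((T + B * W) / 2)) * c =
  c + L * M1 * P * (c * (T + B * W) / 2)); last by ring.
lra.
Qed.

Lemma equation_solvable l f : 0 <= l -> bounded_continuous f ->
  exists2 h, bounded_continuous h & forall u, h u + l * A h u = f u.
Proof.
move=> l0 fS.
have [K K0 AK] := kernel_op_bounded; have [M M0 hM] := apriori_bound l0.
apply: (continuity_method K0 M0 _ _ AK hM) => //.
- move=> h hS.
  exact: (bounded_continuous_kernel_op a0 a1 phi_cont phi_ge0 phi_le T0 r1 hS).
- move=> g h gS hS u.
  exact: (kernel_opB a0 a1 phi_cont phi_ge0 phi_le T0 r1 u gS hS).
- by rewrite l0 lexx.
Qed.

(** The difference solves the homogeneous equation, so the a priori bound holds for it with every
    positive c; c = e / M gives |g - h| <= e. *)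
Lemma equation_injective l g h : 0 <= l -> bounded_continuous g -> bounded_continuous h ->
  (forall u, g u + l * A g u = h u + l * A h u) -> forall u, g u = h u.
Proof.
move=> l0 gS hS gh u; have [M M0 hM] := apriori_bound l0.
have dS := bounded_continuousB gS hS.
apply/eqP; rewrite -subr_eq0 -normr_le0; apply/ler_addgt0Pr => e e0; rewrite add0r.
have := hM l _ _ (e / M) dS _ _ u.
rewrite [M * _]mulrC divfK ?gt_eqF//; apply; first by rewrite l0 lexx.
  by rewrite divr_gt0.
move=> x; rewrite (kernel_opB a0 a1 phi_cont phi_ge0 phi_le T0 r1 x gS hS).
rewrite (_ : g x - h x + l * (A g x - A h x) = 0) ?normr0 ?divr_ge0 ?ltW//.
by have := gh x; lra.
Qed.

End well_posedness.

(** * The derivative of K in closed form *)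

Section derivative_of_the_kernel.
Context {R : realType} (a p q k : R).
Notation mu := (@lebesgue_measure R).
Implicit Types (s t v x y z : R).

Let w z : R := (1 - z) `^ p * z `^ q.

(** The quotient of N(s, v) by s ^ a (s - v) ^ (a - 1) as a function of y = v / s. The last factor,
    y + 2 (1 - y) z, comes from the product rule in [derive1_kernel_integral]; the clamp extends the
    function continuously to the line. *)
Definition profile y : R :=
  k * \int[mu]_(z in `]0, 1[) (w z * ((clamp 1 y + (1 - clamp 1 y) * z) `^ (a - 1) *
    (clamp 1 y + 2 * (1 - clamp 1 y) * z))).

Context (a0 : 0 < a) (a1 : a < 1) (p1 : -1 < p) (q1 : -1 < q) (pqa : p + q = a - 1)
  (k0 : 0 <= k).

Let w_ge0 z : 0 <= w z. Proof. by rewrite mulr_ge0 ?powR_ge0. Qed.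

Let iw : mu.-integrable `]0, 1[ (EFin \o w).
Proof.
have q10 : 0 < q + 1 by have := q1; lra.
have p10 : 0 < p + 1 by have := p1; lra.
have := integrable_beta q10 p10.
by apply: eq_integrable; [by []|move=> z _; rewrite /= !addrK mulrC].
Qed.

Let mw (D : set (measurableTypeR R)) : measurable_fun D (w : measurableTypeR R -> R).
Proof.
apply: measurable_funM; last exact: measurable_powR_itv.
apply: measurable_funTS; apply: (measurableT_comp (measurable_powR p)).
exact: measurable_funB.
Qed.

Let wM_integrable (f : R -> R) (M : R) : measurable_fun setT f ->
  (forall z, 0 < z < 1 -> `|f z| <= M) ->
  mu.-integrable `]0, 1[ (EFin \o (fun z => w z * f z)).
Proof.
move=> mf fM; apply: (@integrable_dominated _ _ _ mu _ (fun z => M * w z)); first by [].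
- by apply: integrableZl_fin; [by []|exact: iw].
- by apply: measurable_funM; [exact: mw|exact: measurable_funTS].
- move=> z; rewrite /= in_itv/= => z01.
  by rewrite normrM (ger0_norm (w_ge0 z)) mulrC ler_wpM2r// fM.
Qed.

Let X_gt0 y z : 0 <= y <= 1 -> 0 < z < 1 -> 0 < y + (1 - y) * z.
Proof.
move=> /andP[y0 y1] /andP[z0 z1].
have : 0 <= y * (1 - z) by rewrite mulr_ge0// subr_ge0 ltW.
lra.
Qed.

(** With X = y + (1 - y) z the last factor is at most 2 X, and X ^ a <= 1. So the blow-up of X ^ (a
    - 1) at y = 0, z -> 0 is compensated uniformly. *)
Let f_bound y z : 0 <= y <= 1 -> 0 < z < 1 ->
  0 <= (y + (1 - y) * z) `^ (a - 1) * (y + 2 * (1 - y) * z) <= 2.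
Proof.
move=> y01 z01; have X0 := X_gt0 y01 z01; case/andP : y01 z01 => y0 y1 /andP[z0 z1].
have yz0 : 0 <= (1 - y) * z by rewrite mulr_ge0 ?subr_ge0// ltW.
rewrite mulr_ge0 ?powR_ge0//=; last by lra.
apply: (@le_trans _ _ ((y + (1 - y) * z) `^ (a - 1) * (2 * (y + (1 - y) * z)))).
  by rewrite ler_wpM2l ?powR_ge0//; lra.
rewrite mulrCA [_ `^ _ * _]mulrC mulr_powRB1 ?(ltW X0)//.
rewrite ger_pMr// -[leRHS](_ : 1 `^ a = 1); last by rewrite powR1.
apply: ge0_ler_powR; rewrite ?nnegrE ?(ltW a0) ?(ltW X0)//.
have : 0 <= (1 - y) * (1 - z) by rewrite mulr_ge0 ?subr_ge0// ltW.
lra.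
Qed.

Lemma profile_ge0 y : 0 <= profile y.
Proof.
rewrite mulr_ge0//; apply: Rintegral_ge0 => z; rewrite /= in_itv/= => z01.
rewrite mulr_ge0//; have := @f_bound (clamp 1 y) z.
by rewrite clamp_ge0 clamp_le// => /(_ isT z01)/andP[].
Qed.

Let measurable_profile_integrand y : measurable_fun setT (fun z =>
  (y + (1 - y) * z) `^ (a - 1) * (y + 2 * (1 - y) * z)).
Proof.
apply: measurable_funM; last exact: measurable_affine.
by apply: (measurableT_comp (measurable_powR _)); exact: measurable_affine.
Qed.

Let c01 y : 0 <= clamp 1 y <= 1. Proof. by rewrite clamp_ge0 clamp_le. Qed.

Let f_norm y z : 0 < z < 1 ->
  `|(clamp 1 y + (1 - clamp 1 y) * z) `^ (a - 1) *
    (clamp 1 y + 2 * (1 - clamp 1 y) * z)| <= 2.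
Proof.
by move=> z01; have /andP[f0 f2] := f_bound (c01 y) z01; rewrite ger0_norm.
Qed.

Lemma profile_le y : profile y <= k * \int[mu]_(z in `]0, 1[) (2 * w z).
Proof.
rewrite ler_wpM2l//; apply: le_Rintegral; [by []| | |].
- by apply: wM_integrable; [exact: measurable_profile_integrand|exact: f_norm].
- by apply: integrableZl_fin; [by []|exact: iw].
- move=> z; rewrite /= in_itv/= => z01; rewrite mulrC ler_wpM2r//.
  exact: le_trans (ler_norm _) (f_norm _ z01).
Qed.

Lemma continuous_profile : continuous profile.
Proof.
have cc : continuous (clamp (1 : R)) by exact: continuous_clamp.
move=> y; apply: cvgM; first exact: cvg_cst.
move: y; apply: (@continuous_Rintegral _ _ _ mu _ _ (fun z => 2 * w z)); first by [].
- move=> y; apply: measurable_funM; first exact: mw.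
  by apply: measurable_funTS; exact: measurable_profile_integrand.
- move=> z; rewrite /= in_itv/= => z01 y.
  have X0 := X_gt0 (c01 y) z01.
  apply: cvgM; first exact: cvg_cst.
  apply: cvgM.
    apply: (@continuous_comp _ _ _ (fun y => clamp 1 y + (1 - clamp 1 y) * z)
      (fun x => x `^ (a - 1))); last exact: cvg_powR.
    apply: cvgD; first exact: cc.
    apply: cvgM; last exact: cvg_cst.
    by apply: cvgB; [exact: cvg_cst|exact: cc].
  apply: cvgD; first exact: cc.
  apply: cvgM; last exact: cvg_cst.
  apply: cvgM; first exact: cvg_cst.
  by apply: cvgB; [exact: cvg_cst|exact: cc].
- by apply: integrableZl_fin; [by []|exact: iw].
- move=> y z; rewrite /= in_itv/= => z01.
  by rewrite normrM (ger0_norm (w_ge0 z)) mulrC ler_wpM2r// f_norm.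
Qed.

Let S_gt0 v t z : 0 < v -> v < t -> 0 < z < 1 -> v < v + (t - v) * z.
Proof. by move=> v0 vt /andP[z0 _]; rewrite ltrDl mulr_gt0// subr_gt0. Qed.

Let S_lt v t z : v < t -> 0 < z < 1 -> v + (t - v) * z < t.
Proof.
move=> vt /andP[_ z1]; have : 0 < (t - v) * (1 - z) by rewrite mulr_gt0 ?subr_gt0.
lra.
Qed.

Let measurable_S_powR e v t : measurable_fun setT (fun z => (v + (t - v) * z) `^ e).
Proof.
by apply: (measurableT_comp (measurable_powR e)); exact: measurable_affine.
Qed.

Let S_powR_le v t z : 0 < v -> v < t -> 0 < z < 1 -> `|(v + (t - v) * z) `^ a| <= t `^ a.
Proof.
move=> v0 vt z01; have S0 := lt_trans v0 (S_gt0 v0 vt z01).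
rewrite ger0_norm ?powR_ge0//; apply: ge0_ler_powR.
- exact: ltW.
- by rewrite nnegrE ltW.
- by rewrite nnegrE ltW// (lt_trans v0 vt).
- exact/ltW/S_lt.
Qed.

(** The substitution frees the bounds and the singular factors from [t], leaving an integrand smooth
    in [t]. The outer exponent is p + q + 1 = a. *)
Lemma kernel_integral_scaled v t : 0 < v -> v < t ->
  \int[mu]_(u in `]v, t[) ((t - u) `^ p * u `^ a * (u - v) `^ q) =
  (t - v) `^ a * \int[mu]_(z in `]0, 1[) (w z * (v + (t - v) * z) `^ a).
Proof.
move=> v0 vt; have tv0 : 0 < t - v by rewrite subr_gt0.
rewrite (Rintegral_itv01 vt); last first.
  apply: measurable_funM; last exact: measurable_shift_powR.
  apply: measurable_funM; last exact: measurable_powR_itv.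
  apply: measurable_funTS; apply: (measurableT_comp (measurable_powR p)).
  exact: measurable_funB.
rewrite (@eq_Rintegral _ _ _ mu _
  (fun z => (t - v) `^ (a - 1) * (w z * (v + (t - v) * z) `^ a))); last first.
  move=> z; rewrite inE/= in_itv/= => /andP[z0 z1]; rewrite -pqa gt0_powRD//.
  have -> : t - (v + (t - v) * z) = (t - v) * (1 - z) by ring.
  have -> : v + (t - v) * z - v = (t - v) * z by ring.
  rewrite !powRM ?(ltW tv0) ?(ltW z0) ?subr_ge0 ?(ltW z1)//.
  by rewrite /w; ring.
rewrite RintegralZl; last 2 first.
- by [].
- by apply: wM_integrable; [exact: measurable_S_powR|move=> z; exact: S_powR_le].
by rewrite mulrA mulr_powRB1// ltW.
Qed.

Let is_derive_S_powR v s z : 0 < v -> v < s -> 0 < z < 1 ->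
  is_derive s 1 (fun t => w z * (v + (t - v) * z) `^ a)
    (w z * (a * (v + (s - v) * z) `^ (a - 1) * z)).
Proof.
move=> v0 vs z01; have S0 := lt_trans v0 (S_gt0 v0 vs z01).
have dS : is_derive s 1 (fun t => v + (t - v) * z) z.
  have -> : (fun t => v + (t - v) * z) = cst (v - v * z) + z *: id.
    by apply/funext => t; rewrite -[RHS]/(v - v * z + z * t); ring.
  have := is_deriveD (is_derive_cst (v - v * z) s 1) (is_deriveZ z (is_derive_id s 1)).
  by rewrite add0r /GRing.scale/= mulr1.
have := @is_derive1_comp R (fun x => x `^ a) (fun t => v + (t - v) * z) s _ _
  (is_derive1_powR a S0) dS.
move=> /(is_deriveZ (w z)).
by [].
Qed.

(** Since v + (t - v) z >= v > 0 and a - 1 < 0, the derivative in t is dominated by a v ^ (a - 1)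
    w(z), uniformly for t in ]v, s + 1[. *)
Lemma is_derive_scaled_integral v s : 0 < v -> v < s ->
  is_derive s 1 (fun t => \int[mu]_(z in `]0, 1[) (w z * (v + (t - v) * z) `^ a))
    (\int[mu]_(z in `]0, 1[) (w z * (a * (v + (s - v) * z) `^ (a - 1) * z))).
Proof.
move=> v0 vs.
pose f t z := w z * (v + (t - v) * z) `^ a.
have Is : `]v, s + 1[%classic s by rewrite /= in_itv/= vs ltrDl ltr01.
have fi t : `]v, s + 1[%classic t -> mu.-integrable `]0, 1[ (EFin \o f t).
  rewrite /= in_itv/= => /andP[vt _].
  by apply: wM_integrable; [exact: measurable_S_powR|move=> z; exact: S_powR_le].
have fd t z : `]v, s + 1[%classic t -> `]0, 1[%classic z ->
    is_derive t 1 (f^~ z) (w z * (a * (v + (t - v) * z) `^ (a - 1) * z)).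
  by rewrite /= !in_itv/= => /andP[vt _] z01; exact: is_derive_S_powR.
have fd1 t z : `]v, s + 1[%classic t -> `]0, 1[%classic z -> derivable (f^~ z) t 1.
  by move=> It Iz; have [] := fd _ _ It Iz.
have fd2 t z : `]v, s + 1[%classic t -> `]0, 1[%classic z ->
    partial1of2 f t z = w z * (a * (v + (t - v) * z) `^ (a - 1) * z).
  by move=> It Iz; rewrite partial1of2E; have [_] := fd _ _ It Iz.
pose D z := a * v `^ (a - 1) * w z.
have D0 z : 0 <= D z by rewrite !mulr_ge0 ?powR_ge0// ltW.
have iD : mu.-integrable `]0, 1[ (EFin \o D).
  by apply: integrableZl_fin; [by []|exact: iw].
have fD t z : `]v, s + 1[%classic t -> `]0, 1[%classic z -> `|partial1of2 f t z| <= D z.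
  move=> It Iz; rewrite fd2//; move: It Iz; rewrite /= !in_itv/= => /andP[vt _] z01.
  have vS := S_gt0 v0 vt z01; case/andP : z01 => z0 z1.
  rewrite ger0_norm; last by rewrite !mulr_ge0 ?powR_ge0// ltW.
  rewrite /D [leRHS]mulrC ler_wpM2l// -[leRHS]mulr1 ler_pM ?mulr_ge0 ?powR_ge0//.
  - exact: ltW.
  - exact: ltW.
  - rewrite ler_wpM2l ?(ltW a0)//; apply: le0_ger_powR => //; last exact: ltW.
    by rewrite subr_le0 ltW.
  - exact: ltW.
have mI : measurable (`]0, 1[ : set (measurableTypeR R)) by [].
split; first exact: (derivable_under_integral mI Is fi fd1 D0 iD fD).
rewrite -derive1E (differentiation_under_integral mI Is fi fd1 D0 iD fD).
by apply: eq_Rintegral => z; rewrite inE => Iz; exact: fd2.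
Qed.

(** With X = v + (s - v) z, the product rule gives a (s - v) ^ (a - 1) times the integral of w X ^
    (a - 1) (X + (s - v) z), and X + (s - v) z = v + 2 (s - v) z. *)
Lemma derive1_kernel_integral (b v s : R) : 0 < v -> v < s ->
  derive1 (fun t => b * \int[mu]_(u in `]v, t[) ((t - u) `^ p * u `^ a * (u - v) `^ q)) s =
  b * a * (s - v) `^ (a - 1) *
  \int[mu]_(z in `]0, 1[) (w z * ((v + (s - v) * z) `^ (a - 1) * (v + 2 * (s - v) * z))).
Proof.
move=> v0 vs; have sv0 : 0 < s - v by rewrite subr_gt0.
rewrite derive1E.
(* The scaled form is valid only for t > v, which holds near [s]. *)
rewrite (@near_eq_derive _ _ _ _ (b *: ((fun t => (t - v) `^ a) *
   (fun t => \int[mu]_(z in `]0, 1[) (w z * (v + (t - v) * z) `^ a))))); last first.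
  near=> t; rewrite kernel_integral_scaled//.
  by near: t; exact: lt_nbhsr.
have d1 : is_derive s 1 (fun t => (t - v) `^ a) (a * (s - v) `^ (a - 1)).
  have dS : is_derive s 1 (fun t => t - v) 1.
    have := is_deriveB (is_derive_id s 1) (is_derive_cst v s 1).
    by rewrite subr0.
  have := @is_derive1_comp R (fun x => x `^ a) (fun t => t - v) s _ _
    (is_derive1_powR a sv0) dS.
  by rewrite mulr1.
have := is_deriveZ b (is_deriveM d1 (is_derive_scaled_integral v0 vs)).
move=> [_ ->]; rewrite /GRing.scale/= -!mulrA; congr (b * _).
set I0 := \int[mu]_(z in _) (w z * (v + (s - v) * z) `^ a).
set I1 := \int[mu]_(z in _) (w z * (a * _ * z)).
suff -> : \int[mu]_(z in `]0, 1[)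
    (w z * ((v + (s - v) * z) `^ (a - 1) * (v + 2 * (s - v) * z))) = I0 + (s - v) / a * I1.
  rewrite -[(s - v) `^ a]mulr_powRB1 ?(ltW sv0)//.
  by field; rewrite gt_eqF.
have i0 : mu.-integrable `]0, 1[ (EFin \o (fun z => w z * (v + (s - v) * z) `^ a)).
  by apply: wM_integrable; [exact: measurable_S_powR|move=> z; exact: S_powR_le].
have i1 : mu.-integrable `]0, 1[
    (EFin \o (fun z => w z * (a * (v + (s - v) * z) `^ (a - 1) * z))).
  apply: (@wM_integrable _ (a * v `^ (a - 1))).
    apply: measurable_funM; last exact: measurable_id.
    by apply: measurable_funM; [exact: measurable_cst|exact: measurable_S_powR].
  move=> z z01; have vS := S_gt0 v0 vs z01; case/andP : z01 => z0 z1.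
  rewrite ger0_norm ?mulr_ge0 ?powR_ge0 ?(ltW a0) ?(ltW z0)//.
  rewrite -[leRHS]mulr1 ler_pM ?mulr_ge0 ?powR_ge0 ?(ltW a0) ?(ltW z0) ?(ltW z1)//.
  rewrite ler_wpM2l ?(ltW a0)//; apply: le0_ger_powR; rewrite ?(ltW vS)//.
  by rewrite subr_le0 ltW.
rewrite /I1 -RintegralZl; [|by []|exact: i1].
rewrite /I0 -RintegralD; [|by []|exact: i0|]; last first.
  by apply: integrableZl_fin; [by []|exact: i1].
apply: eq_Rintegral => z; rewrite inE/= in_itv/= => z01.
have S0 := lt_trans v0 (S_gt0 v0 vs z01).
rewrite -[(v + (s - v) * z) `^ a]mulr_powRB1 ?(ltW S0)//.
by field; rewrite gt_eqF.
Unshelve. all: end_near. Qed.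

Lemma ker_profile v s : 0 <= v -> v < s -> ker a profile s v =
  k * (s - v) `^ (a - 1) *
  \int[mu]_(z in `]0, 1[) (w z * ((v + (s - v) * z) `^ (a - 1) * (v + 2 * (s - v) * z))).
Proof.
move=> v0 vs; have s0 : 0 < s by exact: le_lt_trans vs.
have vs01 : 0 <= v / s <= 1 by rewrite divr_ge0 ?(ltW s0)// ler_pdivrMr// mul1r ltW.
rewrite kerE// /profile clamp_id//.
set I1 := \int[mu]_(z in _) _; set I2 := \int[mu]_(z in _) _.
suff -> : I2 = s `^ a * I1 by ring.
rewrite /I1 -RintegralZl; last 2 first.
- by [].
- apply: wM_integrable; first exact: measurable_profile_integrand.
  by move=> z z01; have := f_norm (v / s) z01; rewrite clamp_id//; apply.
apply: eq_Rintegral => z; rewrite inE/= in_itv/= => z01.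
have X0 := X_gt0 vs01 z01.
have -> : v + (s - v) * z = s * (v / s + (1 - v / s) * z) by field; rewrite gt_eqF.
have -> : v + 2 * (s - v) * z = s * (v / s + 2 * (1 - v / s) * z) by field; rewrite gt_eqF.
rewrite powRM ?(ltW s0) ?(ltW X0)//.
by rewrite -[s `^ a]mulr_powRB1 ?(ltW s0)//; ring.
Qed.

End derivative_of_the_kernel.

(** * Identification of kappa and solution of the original equation *)

Section kernel_kappa.
Context {R : realType} (H1 H2 T : R).
Notation mu := (@lebesgue_measure R).
Implicit Types (s u v x y : R).

Let a := H2 - H1.
Let r := 2 * H2 - 1.
Let phi := profile a (1 / 2 - H1) (H2 - 3 / 2) (betaH H2 * a).
Let C := betaH H2 * a * \int[mu]_(z in `]0, 1[)
  (2 * ((1 - z) `^ (1 / 2 - H1) * z `^ (H2 - 3 / 2))).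
Notation N := (ker a phi).
Notation G := (volterra a T phi).
Notation A := (kernel_op a T r phi).

Context (hH1 : 1 / 2 <= H1) (hH12 : H1 < H2) (hH2 : H2 < 1) (T0 : 0 < T).

Let a0 : 0 < a. Proof. by rewrite subr_gt0. Qed.
Let a1 : a < 1. Proof. by rewrite /a; have := hH1; have := hH2; lra. Qed.
Let p1 : -1 < 1 / 2 - H1. Proof. by have := hH12; have := hH2; lra. Qed.
Let q1 : -1 < H2 - 3 / 2. Proof. by have := hH12; have := hH1; lra. Qed.
Let pqa : 1 / 2 - H1 + (H2 - 3 / 2) = a - 1. Proof. by rewrite /a; field. Qed.
Let k0 : 0 <= betaH H2 * a. Proof. by rewrite mulr_ge0 ?sqrtr_ge0// ltW. Qed.
Let r1 : r < 1. Proof. by rewrite /r; have := hH2; lra. Qed.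
Let r2aE : r - 2 * a = 2 * H1 - 1. Proof. by rewrite /r /a; ring. Qed.
Let r2a : 0 <= r - 2 * a. Proof. by rewrite r2aE; have := hH1; lra. Qed.

Let phi_cont : continuous phi. Proof. exact: continuous_profile. Qed.
Let phi_ge0 y : 0 <= phi y. Proof. exact: profile_ge0. Qed.
Let phi_le y : phi y <= C. Proof. exact: profile_le. Qed.

Lemma dKkerE s v : 0 < v -> v < s -> dKker H1 H2 s v = v `^ (1 / 2 - H2) * N s v.
Proof.
move=> v0 vs; rewrite /dKker /Kker derive1_kernel_integral//.
by rewrite /phi ker_profile ?(ltW v0)// /a; ring.
Qed.

(** The upper limit may be raised from min(s, u) to u because N(s, v) = 0 for v >= s. The two
    prefactors v ^ (1/2 - H2) combine to v ^ (- r). *)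
Lemma kkerE s u : 0 < s -> 0 < u ->
  kker H1 H2 s u = \int[mu]_(v in `]0, u[) (v `^ (- r) * N s v * N u v).
Proof.
move=> s0 u0; rewrite /kker [RHS](@Rintegral_extend _ `]0, (Num.min s u)[); last 2 first.
- by apply: subset_itvl; rewrite bnd_simp ge_min lexx orbT.
- move=> v /=; rewrite !in_itv/= lt_min => /andP[v0 vu] /negP.
  by rewrite v0 vu andbT/= -leNgt => sv; rewrite (ker_eq0 _ _ sv) mulr0 mul0r.
apply: eq_Rintegral => v; rewrite inE/= in_itv/= lt_min => /and3P[v0 vs vu].
rewrite !dKkerE// (_ : - r = (1 / 2 - H2) + (1 / 2 - H2)); last by rewrite /r; field.
by rewrite [v `^ (1 / 2 - H2 + _)]gt0_powRD//; ring.
Qed.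

Lemma kappaE s u : 0 < s -> 0 < u -> s != u -> kappa H1 H2 s u =
  u `^ (r - 2 * a) * \int[mu]_(v in `]0, u[) (v `^ (- r) * N s v * N u v).
Proof.
move=> s0 u0 su; rewrite /kappa (negbTE su) gt_eqF// kkerE//.
by rewrite r2aE.
Qed.

(** For small x > 0, [mker_subst] with g = N(s, .) turns x ^ (2 H1 - 1) k(s, x) into the integral of
    m(y) N(s, x y), and dominated convergence lets x tend to 0. *)
Lemma kappa_axis s : 0 < s ->
  kappa H1 H2 s 0 = (\int[mu]_(y in `]0, 1[) mker a r phi y) * N s 0.
Proof.
move=> s0; rewrite /kappa gt_eqF// eqxx.
have s20 : 0 <= s / 2 by rewrite divr_ge0 ?ltW.
(* Stopping at s / 2 keeps away from the singularity v = s, so that [g] is bounded and continuous;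
   it agrees with N(s, .) on [0, s / 2]. *)
pose g v := N s (clamp (s / 2) v).
have clt v : clamp (s / 2) v < s.
  by apply: (le_lt_trans (clamp_le _ s20)); rewrite ltr_pdivrMr// ltr_pMr// ltr1n.
have gE v : g v = s `^ a * (s - clamp (s / 2) v) `^ (a - 1) * phi (clamp (s / 2) v / s).
  by rewrite /g kerE ?clamp_ge0.
have gM v : `|g v| <= C * s `^ a * (s / 2) `^ (a - 1).
  rewrite ger0_norm ?ker_ge0//; apply: (le_trans (ker_le a0 phi_ge0 phi_le (clt v) (lexx s))).
  rewrite ler_wpM2l//.
    by rewrite mulr_ge0 ?powR_ge0//; exact: le_trans (phi_ge0 0) (phi_le 0).
  apply: le0_ger_powR; first by rewrite subr_le0 ltW.
    by rewrite divr_gt0.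
  by have := clamp_le v s20; lra.
have cg : continuous g.
  rewrite (_ : g = fun v => s `^ a * (s - clamp (s / 2) v) `^ (a - 1) *
    phi (clamp (s / 2) v / s)); last by apply/funext.
  move=> v; apply: cvgM; first apply: cvgM.
  - exact: cvg_cst.
  - apply: (@continuous_comp _ _ _ (fun v => s - clamp (s / 2) v) (fun x => x `^ (a - 1))).
      by apply: cvgB; [exact: cvg_cst|exact: continuous_clamp].
    by apply: cvg_powR; rewrite subr_gt0.
  - apply: (@continuous_comp _ _ _ (fun v => clamp (s / 2) v / s) phi); last exact: phi_cont.
    by apply: cvgM; [exact: continuous_clamp|exact: cvg_cst].
have mg : measurable_fun setT g by exact: continuous_measurable_fun.
set B := C * _ * _ in gM.
have cF : continuous (fun x => \int[mu]_(y in `]0, 1[) (mker a r phi y * g (x * y))).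
  apply: (@continuous_Rintegral _ _ _ mu _ _ (fun y => B * mker a r phi y)); first by [].
  - move=> x; apply: measurable_funM; first exact: measurable_mker.
    by apply: measurable_funTS; apply: (measurableT_comp mg); exact: measurable_funM.
  - move=> y _ x; apply: cvgM; first exact: cvg_cst.
    apply: (@continuous_comp _ _ _ (fun x => x * y) g); last exact: cg.
    by apply: cvgM; [exact: cvg_id|exact: cvg_cst].
  - apply: integrableZl_fin; first by [].
    exact: (integrable_mker a0 phi_cont phi_ge0 phi_le r1).
  - move=> x y _; rewrite normrM (ger0_norm (mker_ge0 _ _ phi_ge0 _)) mulrC.
    by rewrite ler_wpM2r// mker_ge0.
have F0 : \int[mu]_(y in `]0, 1[) (mker a r phi y * g (0 * y)) =
    (\int[mu]_(y in `]0, 1[) mker a r phi y) * N s 0.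
  rewrite -RintegralZr; [|by []|exact: (integrable_mker a0 phi_cont phi_ge0 phi_le r1)].
  by apply: eq_Rintegral => y _; rewrite mul0r /g clamp_id// lexx.
apply/cvg_lim => //; rewrite -F0.
have := cvg_at_right_filter (cF 0).
apply: cvg_trans; apply: near_eq_cvg; near=> x.
have x0 : 0 < x by near: x; exact: nbhs_right_gt.
have xs : x < s / 2 by near: x; apply: nbhs_right_lt; rewrite divr_gt0.
rewrite kkerE// -r2aE.
have := mker_subst a0 phi_cont phi_ge0 phi_le r1 mg gM x0.
rewrite (@eq_Rintegral _ _ _ mu _ (fun v => v `^ (- r) * N s v * N x v)); last first.
  move=> v; rewrite inE/= in_itv/= => /andP[v0 vx].
  by rewrite /g clamp_id ?(ltW v0) ?(ltW (lt_trans vx xs))//; ring.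
move=> ->; rewrite mulrA -gt0_powRD// (_ : r - 2 * a + (2 * a - r) = 0); last by ring.
by rewrite powRr0 mul1r.
Unshelve. all: end_near. Qed.

Lemma integral_kappa (h : R -> R) u : bounded_continuous h -> 0 <= u <= T ->
  (\int[mu]_(s in `[0%R, T]) (h s * kappa H1 H2 s u)%:E = (A h u)%:E)%E.
Proof.
move=> hS /andP[u0 uT]; have [ch [M hM]] := hS.
have mh : measurable_fun setT h by exact: continuous_measurable_fun.
suff [mf <-] : measurable_fun `]0, T[ (EFin \o (fun s => h s * kappa H1 H2 s u)) /\
    (\int[mu]_(s in `]0%R, T[) (h s * kappa H1 H2 s u)%:E = (A h u)%:E)%E.
  by rewrite integral_itv_bndoo.
have mI : measurable (`]0, T[ : set (measurableTypeR R)) by [].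
move: u0; rewrite le_eqVlt => /predU1P[<-|u0].
  pose M1 := \int[mu]_(y in `]0, 1[) mker a r phi y.
  have iN : mu.-integrable `]0, T[ (EFin \o (fun s => N s 0 * h s)).
    exact: (integrable_volterra_extend T a0 phi_cont phi_ge0 phi_le mh hM (lexx 0)).
  have sub0 : `]0, T[ `\ 0 `<=` (`]0, T[ : set R) by move=> x [].
  (* The removed point 0 lies outside ]0, T[, so nothing is lost. In (A h)(0) the factor (G h)(0) is
     constant in y and leaves [M1]. *)
  apply: (@integral_punctured _ _ 0 _ (fun s => M1 * (N s 0 * h s))).
  - exact: mI.
  - apply: integrableZl_fin; first exact: measurableD.
    by apply: integrableS iN => //; exact: measurableD.
  - move=> s [/=]; rewrite in_itv/= => /andP[s0 _] _.
    by rewrite kappa_axis// -/M1; ring.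
  - rewrite not_setD1; last by rewrite /= in_itv/= ltxx.
    rewrite RintegralZl; [|exact: mI|exact: iN].
    rewrite volterra_extend// /kernel_op.
    rewrite -RintegralZr; [|by []|exact: (integrable_mker a0 phi_cont phi_ge0 phi_le r1)].
    apply: eq_Rintegral => y _.
    have c0 : clamp T 0 = 0 by rewrite clamp_id// lexx ltW.
    by rewrite c0 mul0r c0.
have u0T : 0 < u <= T by rewrite u0.
have [iF FE] := kernel_op_fubini a0 a1 phi_cont phi_ge0 phi_le T0 r1 hS u0T.
apply: (@integral_punctured _ _ u _ (fun s => u `^ (r - 2 * a) *
    (h s * \int[mu]_(v in `]0, u[) (v `^ (- r) * N s v * N u v)))).
- exact: mI.
- by apply: integrableZl_fin; [exact: measurableD|exact: iF].
- move=> s [/=]; rewrite in_itv/= => /andP[s0 _] /eqP su.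
  by rewrite kappaE// mulrCA.
- rewrite RintegralZl; [|exact: measurableD|exact: iF].
  rewrite FE mulrA -gt0_powRD// (_ : r - 2 * a + (2 * a - r) = 0); last by ring.
  by rewrite powRr0 mul1r.
Qed.

Let lam := (gammaH H1 ^+ 2)^-1.

Let lam_ge0 : 0 <= lam. Proof. by rewrite invr_ge0 sqr_ge0. Qed.

Let is_solutionE (h : R -> R) : bounded_continuous h ->
  (forall u, 0 <= u <= T -> h u + lam * A h u = 1) <->
  (forall u, 0 <= u <= T -> ((h u)%:E + lam%:E *
    \int[mu]_(s in `[0%R, T]) (h s * kappa H1 H2 s u)%:E = 1)%E).
Proof.
move=> hS; split=> E u u0T; have := E u u0T.
  by rewrite integral_kappa// -EFinM -EFinD => ->.
by rewrite integral_kappa// -EFinM -EFinD => -[].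
Qed.

(** Boundedness comes from the extreme value theorem. This brings an arbitrary competitor on [0, T]
    into the whole-line setting where uniqueness is proved. *)
Lemma clamp_bounded_continuous (g : R -> R) : {within `[0, T], continuous g} ->
  bounded_continuous (g \o clamp T).
Proof.
move=> cg; have c0T x : `[0, T]%classic (clamp T x).
  by rewrite /= in_itv/= clamp_ge0 clamp_le// ltW.
have [c _ gc] := EVT_max (ltW T0) cg.
have [d _ gd] := EVT_min (ltW T0) cg.
split; last first.
  exists (Num.max (g c) (- g d)) => x; rewrite ler_norml.
  have := gc _ (c0T x); have := gd _ (c0T x) => h1 h2.
  by rewrite /= le_max h2/= lerNl le_max lerN2 h1 orbT.
move=> x; have /subspace_continuousP/(_ _ (c0T x)) cgx := cg.
apply: cvg_comp cgx => U HU.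
have near_c : \forall y \near x, `[0, T]%classic (clamp T y) -> U (clamp T y).
  exact: (@continuous_clamp R T x _ HU).
suff : \forall y \near x, U (clamp T y) by [].
by apply: filterS near_c => y; apply; exact: c0T.
Qed.

Lemma kernel_op_clamp (h : R -> R) u : A h (clamp T u) = A h u.
Proof.
have cc : clamp T (clamp T u) = clamp T u by rewrite clamp_id// clamp_ge0 clamp_le// ltW.
by rewrite /kernel_op cc.
Qed.

Lemma exists_unique_solution : exists h : R -> R, is_solution H1 H2 T h /\
  forall g : R -> R, is_solution H1 H2 T g -> forall u, 0 <= u <= T -> g u = h u.
Proof.
have f1 : bounded_continuous (cst 1 : R -> R).
  by split; [move=> x; exact: cvg_cst|exists 1 => x; rewrite normr1].
have [h hS hE] := equation_solvable a0 a1 phi_cont phi_ge0 phi_le T0 r1 r2a lam_ge0 f1.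
exists h; split.
  split; first by apply: continuous_subspaceT; case: hS.
  by apply/(is_solutionE hS) => u _; exact: hE.
move=> g [cg gE] u u0T.
have gS := clamp_bounded_continuous cg.
have gsE : forall u, 0 <= u <= T -> (g \o clamp T) u + lam * A (g \o clamp T) u = 1.
  apply/(is_solutionE gS) => v v0T; rewrite -(gE v v0T) /= clamp_id//.
  congr (_ + _ * _)%E; apply: eq_integral => s; rewrite inE/= in_itv/= => s0T.
  by rewrite clamp_id.
have -> : g u = (g \o clamp T) u by rewrite /= clamp_id.
(* The clamped competitor satisfies the equation on the whole line: both it and its image under A
   depend on v only through [clamp T v], and the right-hand side is constant. *)
apply: (equation_injective a0 a1 phi_cont phi_ge0 phi_le T0 r1 r2a lam_ge0 gS hS) => v.
have c0T : 0 <= clamp T v <= T by rewrite clamp_ge0 clamp_le// ltW.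
rewrite hE; have := gsE _ c0T; rewrite kernel_op_clamp /= => <-.
by rewrite (clamp_id c0T).
Qed.

End kernel_kappa.

Theorem theorem1 (R : realType) (H1 H2 : R)
    (hH1 : 1 / 2 <= H1) (hH12 : H1 < H2) (hH2 : H2 < 1) :
  exists T : nat -> R,
    (forall n, 0 < T n) /\
    T n @[n --> \oo] --> +oo /\
    forall n, exists h : R -> R,
      is_solution H1 H2 (T n) h /\
      forall g : R -> R, is_solution H1 H2 (T n) g ->
        forall u : R, 0 <= u <= T n -> g u = h u.
Proof.
(* Every positive T works; the shift by one makes the first term positive. *)
exists (fun n => n.+1%:R); split; first by move=> n; rewrite ltr0n.
split; last by move=> n; apply: exists_unique_solution; rewrite ?ltr0n.
apply/cvgryPge => M; near=> n.
apply: (@le_trans _ _ n%:R); last by rewrite ler_nat.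
by near: n; exact: nbhs_infty_ger.
Unshelve. all: end_near. Qed.
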